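(* Let $\Lambda=A_9\oplus A_9\oplus A_1+\mathbb{Z}(\alpha_9,2\alpha_9,\alpha_1)$, $r=(0,0,2\alpha_1)$, and $X=\{\gamma\in\Lambda : (\gamma,\gamma)=3,\ (\gamma,r)=1\}$. Every maximum affine equiangular set contained in $X$ with respect to $r$ is strongly maximal.
   Context: $A_n=\{x\in\mathbb{Z}^{n+1} : \sum_i x_i=0\}$ with the standard inner product, and $\alpha_n=\left(\frac1{n+1},\dots,\frac1{n+1},-\frac n{n+1}\right)$; vectors of the orthogonal direct sum are written $(x,y,z)$ with $x,y\in\mathbb{R}^{10}$, $z\in\mathbb{R}^2$. An affine equiangular set with norm $s$ with respect to a root $r$ (a vector with $(r,r)=2$) is a set of distinct vectors $u_1,\dots,u_n$ with $(u_i,r)=1$, $(u_i,u_i)=s$ for all $i$ and $(u_i,u_j)\in\{0,1\}$ for $i\neq j$. Affine equiangular sets in $X$ have norm $3$. ''Maximum'' means having the largest cardinality among all affine equiangular sets with respect to $r$ contained in $X$. An affine equiangular set $\omega$ with respect to $r$ is strongly maximal if there is no affine equiangular set with respect to $r$ properly containing $\omega$, even if the dimension of the underlying Euclidean space is increased. *)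

(* Defs.v *)
From HB Require Import structures.
From mathcomp Require Import all_boot all_order all_algebra finmap.
From mathcomp Require Import classical_sets reals.

Set Implicit Arguments.
Unset Strict Implicit.
Unset Printing Implicit Defensive.

Import Order.TTheory GRing.Theory Num.Theory.

Local Open Scope fset_scope.
Local Open Scope classical_set_scope.
Local Open Scope ring_scope.

Section EquiangularSets.
Variable R : realType.

Definition dotv (d : nat) (u v : 'rV[R]_d) : R := \sum_(i < d) u 0 i * v 0 i.

Definition is_root (d : nat) (r : 'rV[R]_d) : Prop := dotv r r = 2.

Definition affine_equiangular_norm (d : nat) (s : R) (r : 'rV[R]_d)
    (w : {fset 'rV[R]_d}) : Prop :=
  [/\ is_root r,
      forall u, u \in w -> dotv u r = 1 /\ dotv u u = s
    & forall u v, u \in w -> v \in w -> u != v ->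
        dotv u v = 0 \/ dotv u v = 1].

Definition affine_equiangular (d : nat) (r : 'rV[R]_d)
    (w : {fset 'rV[R]_d}) : Prop :=
  exists s : R, affine_equiangular_norm s r w.

Definition maximum_in (d : nat) (r : 'rV[R]_d) (X : set 'rV[R]_d)
    (w : {fset 'rV[R]_d}) : Prop :=
  [/\ affine_equiangular r w,
      [set` w] `<=` X
    & forall w' : {fset 'rV[R]_d},
        affine_equiangular r w' -> [set` w'] `<=` X ->
        (#|` w'| <= #|` w|)%N].

Definition widen (d k : nat) (u : 'rV[R]_d) : 'rV[R]_(d + k) := row_mx u 0.

(* Enlarging the Euclidean space is modelled by the standard isometric
   inclusion of R^d in R^(d + k); the case k = 0 is included. *)
Definition strongly_maximal (d : nat) (r : 'rV[R]_d)
    (w : {fset 'rV[R]_d}) : Prop :=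
  affine_equiangular r w /\
  forall (k : nat) (w' : {fset 'rV[R]_(d + k)}),
    affine_equiangular (widen k r) w' ->
    ~ ([fset widen k u | u in w] `<` w')%fset.

Definition root_lattice_A (n : nat) : set 'rV[R]_n.+1 :=
  [set x | (forall i, x 0 i \is a Num.int) /\ \sum_i x 0 i = 0].

Definition alpha (n : nat) : 'rV[R]_n.+1 :=
  \row_(i < n.+1) if i == ord_max then - (n%:R / n.+1%:R) else n.+1%:R^-1.

Definition vec3 (x y : 'rV[R]_10) (z : 'rV[R]_2) : 'rV[R]_(10 + 10 + 2) :=
  row_mx (row_mx x y) z.

Definition Lambda : set 'rV[R]_(10 + 10 + 2) :=
  [set g | exists (x y : 'rV[R]_10) (z : 'rV[R]_2) (m : int),
     [/\ root_lattice_A x, root_lattice_A y, root_lattice_A z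
       & g = vec3 x y z + vec3 (alpha 9) (2 *: alpha 9) (alpha 1) *~ m]].

Definition r0 : 'rV[R]_(10 + 10 + 2) := vec3 0 0 (2 *: alpha 1).

Definition X0 : set 'rV[R]_(10 + 10 + 2) :=
  [set g | [/\ Lambda g, dotv g g = 3 & dotv g r0 = 1]].

End EquiangularSets.

Arguments r0 {R}.
Arguments X0 {R}.

(* Main.v *)
Require Import Defs.
From mathcomp Require Import classical_sets reals trigo.
From mathcomp Require Import all_boot all_order all_algebra finmap complex.
From mathcomp Require Import ring lra zify.

(* Modulo the r-component, the vectors of [X0] are
     +-(1/10 - e_i, 1/5 - e_j - e_k)   and   (1/2 - 1_D, 0) with |D| = 5.
   Two vectors of different kinds may always occur together; vectors of the
   first kind may occur together exactly when giving the edge {j,k} the colour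
   i is a proper edge colouring, those of the second kind exactly when the sets
   D meet in 2 or 3 points.  Hence a maximum set consists of a proper colouring
   of all 45 edges of K_10 by at most 10 colours and of at least 12 sets D.

   Let v extend such a set in a larger space, and let (a, b) be the components
   of v along the two copies of A_9.  Then b_j + b_k + a_i = +-1/2 for every
   edge {j,k} of colour i, and the sum of a over each D is +-1/2.  With
   z_j = exp(2 pi i b_j) and w_i = - exp(- 2 pi i a_i) this says z_j z_k = w_i,
   and the products of all z_j and of all w_i are 1.  Counting colours around a
   vertex leaves two cases.  Either w takes each fifth root of unity exactly
   twice; then the product of w over each D is 1, which leaves room for at most
   10 sets D.  Or z and w are constant; then (a, b) lies in the dual lattice,
   whose short vectors show that v already lies in [X0], against maximality. *)

Set Implicit Arguments.
Unset Strict Implicit.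
Unset Printing Implicit Defensive.

Import Order.TTheory GRing.Theory Num.Theory.

Local Open Scope ring_scope.

(** * Edge colourings of K_10 by products *)

(** Handshake argument: a related pair is counted once with i < j and once with j < i. *)
Lemma sum_sym_even (n : nat) (r : rel 'I_n) : symmetric r -> irreflexive r ->
  ~~ odd (\sum_i \sum_j r i j)%N.
Proof.
move=> r_sym r_irr.
have -> : (\sum_i \sum_j r i j = (\sum_(i < n) \sum_(j < n) (r i j && (i < j))).*2)%N.
  rewrite -addnn [X in _ = (_ + X)%N]exchange_big -big_split.
  apply: eq_bigr => i _; rewrite -big_split; apply: eq_bigr => j _ /=.
  rewrite [r j i]r_sym; case: ltngtP => [||/val_inj->]; rewrite ?r_irr //.
    by rewrite andbT andbF addn0.
  by rewrite andbT andbF.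
by rewrite odd_double.
Qed.

Section ProductColoring.
Variables (F : fieldType) (z w : 'I_10 -> F) (c : 'I_10 -> 'I_10 -> 'I_10).
Hypothesis two_neq0 : 2%:R != 0 :> F.
Hypothesis z_neq0 : forall j, z j != 0.
Hypothesis c_sym : forall j k, c j k = c k j.
Hypothesis c_inj : forall j k l, j != k -> j != l -> c j k = c j l -> k = l.
Hypothesis mul_z : forall j k, j != k -> z j * z k = w (c j k).
Hypothesis prod_z : \prod_j z j = 1.
Hypothesis prod_w : \prod_i w i = 1.

Local Notation mz t := (count_mem t (codom z)).
Local Notation mw s := (count_mem s (codom w)).
Local Notation T := (undup (codom z)).

(** Nine distinct colours meet at j, so exactly one of the ten is missing there. Giving that colour
    to j itself completes the star to a bijection. *)
Lemma star_perm j : exists2 p : 'I_10 -> 'I_10, injective p &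
  forall k, j != k -> p k = c j k.
Proof.
have /card_gt0P[m] : (0 < #|[predC [seq c j k | k in predC1 j]]|)%N.
  rewrite -(ltn_add2l #|[seq c j k | k in predC1 j]|) cardC addn0.
  apply: leq_ltn_trans (leq_image_card _ _) _.
  by rewrite cardC1 card_ord.
rewrite inE => mN.
have mN' k : j != k -> m != c j k.
  move=> jk; apply: contra mN => /eqP->; apply: image_f.
  by rewrite inE eq_sym.
exists (fun k => if j == k then m else c j k) => [k l|k /negPf->//].
case: eqVneq => [<-|jk]; case: eqVneq => [<-|jl] // E.
- by move/eqP: (mN' _ jl); rewrite E.
- by move/eqP: (mN' _ jk); rewrite E.
exact: c_inj jk jl E.
Qed.

Lemma mem_T j : z j \in T.
Proof. by rewrite mem_undup codom_f. Qed.

Lemma TP t : t \in T -> exists j, t = z j.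
Proof. by rewrite mem_undup => /codomP. Qed.

Lemma T_neq0 t : t \in T -> t != 0.
Proof. by move=> /TP[j ->]. Qed.

Lemma mz_gt0 t : (0 < mz t)%N = (t \in T).
Proof. by rewrite mem_undup -has_pred1 has_count. Qed.

Lemma count_codom (f : 'I_10 -> F) s : count_mem s (codom f) = (\sum_k (f k == s))%N.
Proof. by rewrite codomE count_map -sum1_count big_mkcond big_enum; apply: eq_bigr => k _; rewrite /=; case: eqP. Qed.

(** Here [p j] is the colour missing at j. The product of all w is 1, and it is w (p j) times the
    product of z_j z_k over the other k, that is, times z_j^9 z_j^-1. *)
Lemma star_missing j (p : 'I_10 -> 'I_10) :
  injective p -> (forall k, j != k -> p k = c j k) -> w (p j) = z j ^- 8.
Proof.
move=> p_inj pE.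
have zj := z_neq0 j.
have := prod_w; rewrite (reindex_inj p_inj) /= (bigD1 j) //=.
have -> : \prod_(i < 10 | i != j) w (p i) = z j ^+ 9 * \prod_(i < 10 | i != j) z i.
  have -> : z j ^+ 9 = \prod_(i < 10 | i != j) z j.
    rewrite (eq_bigl (fun i => i \in predC1 j)) => [|i]; last by rewrite inE.
    by rewrite prodr_const cardC1 card_ord.
  rewrite -big_split /=; apply: eq_bigr => k kj.
  by rewrite pE 1?eq_sym // mul_z // eq_sym.
have <- : (z j)^-1 = \prod_(i < 10 | i != j) z i.
  by have := prod_z; rewrite (bigD1 j) //= => /(canRL (mulKf zj)) ->; rewrite mulr1.
move=> H; apply: (mulIf (expf_neq0 8 zj)); rewrite mulVf ?expf_neq0 //.
by rewrite -[RHS]H [z j ^+ 9]exprSr mulfK.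
Qed.

(** Reindexed by the star at a vertex j with z_j = t, the values of w are t z_k for k other than j,
    and t^-8 at j. The two indicators exchange the absent t z_j = t^2 for t^-8. *)
Lemma star_count t s : t \in T ->
  (mw s + (s == t ^+ 2) = mz (s / t)%R + (s == t ^- 8))%N.
Proof.
move=> /TP[j ->]; have zj := z_neq0 j.
have [p p_inj pE] := star_perm j.
rewrite !count_codom (reindex_inj p_inj) /= (bigD1 j) //=.
rewrite (star_missing p_inj pE) [in RHS](bigD1 j) //=.
have -> : (z j == s / z j) = (s == z j ^+ 2).
  by rewrite -(inj_eq (mulIf zj)) divfK // eq_sym expr2.
rewrite [z j ^- 8 == s]eq_sym.
rewrite (eq_bigr (fun k => nat_of_bool (z k == s / z j))) => [|k kj].
  by rewrite -addnA addnC [X in (X + _)%N]addnC.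
rewrite pE 1?eq_sym // -mul_z 1?eq_sym //.
by rewrite -[in RHS](inj_eq (mulfI zj)) mulrCA divff ?mulr1 // eq_sym.
Qed.

Lemma mul_expV9 (x : F) : x != 0 -> x * x ^- 9 = x ^- 8.
Proof. by move=> x0; field. Qed.

(** The multiplicity of t u in w is computed by [star_count] both from t and from u. *)
Lemma mz_diff t u : t \in T -> u \in T -> t != u ->
  (mz u + (u == t ^- 9) = mz t + (t == u ^- 9))%N.
Proof.
move=> tT uT tu; have t0 := T_neq0 tT; have u0 := T_neq0 uT.
have := star_count (t * u) uT; have := star_count (t * u) tT.
rewrite [t * u / t]mulrC mulKf // mulfK //.
rewrite expr2 (inj_eq (mulfI t0)) eq_sym (negPf tu) addn0 => ->.
rewrite expr2 (inj_eq (mulIf u0)) (negPf tu) addn0.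
have -> : (t * u == t ^- 8) = (u == t ^- 9).
  by rewrite -(inj_eq (mulfI t0) u) mul_expV9.
have -> // : (t * u == u ^- 8) = (t == u ^- 9).
by rewrite -(inj_eq (mulfI u0) t) mul_expV9 // mulrC.
Qed.

Lemma dvdn_fibers (P : pred F) (m : nat) :
  {in T, forall t, P t -> mz t = m} -> (m %| count P (codom z))%N.
Proof.
move=> H; rewrite -sum1_count -big_undup_iterop_count big_seq_cond.
apply: dvdn_sum => t /andP[tT Pt].
by rewrite Monoid.iteropE -(H t tT Pt) iter_addn_0 mul1n.
Qed.

Lemma size_codom10 : size (codom z) = 10%N.
Proof. by rewrite size_codom card_ord. Qed.

(** If t is rarer than u, then [mz_diff] gives t = u^-9 and multiplicities differing by one, and
    every value except t is as frequent as u. So mz u divides 10 - mz t = 11 - mz u, hence the prime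
    11; neither 1 nor 11 is possible. *)
Lemma mz_const : {in T &, forall t u, mz t = mz u}.
Proof.
suff H : {in T &, forall t u, ~ (mz t < mz u)%N}.
  move=> t u tT uT; case: (ltngtP (mz t) (mz u)) => // L.
  - by case: (H t u tT uT).
  - by case: (H u t uT tT).
move=> t u tT uT L.
have tu : t != u by apply: contraTneq L => ->; rewrite ltnn.
have E := mz_diff tT uT tu.
have tE : t = u ^- 9.
  by apply/eqP; apply: contraTT L => /negPf tE; move: E; rewrite tE addn0 -leqNgt => <-; exact: leq_addr.
have uE : (mz u = (mz t).+1)%N.
  by move: E L; rewrite -tE eqxx addn1; case: eqP => _; rewrite ?addn1 ?addn0 // => -[->]; rewrite ltnn.
have others : {in T, forall v, v != t -> mz v = mz u}.
  move=> v vT vt; have [->//|vu] := eqVneq v u.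
  have uv : u != v by rewrite eq_sym.
  have tv : t != v by rewrite eq_sym.
  have := mz_diff uT vT uv; rewrite -tE (negPf vt) addn0.
  case: eqP => _; rewrite ?addn0 // => E1.
  (* Otherwise v would exceed t in multiplicity by two, while [mz_diff] allows at most one. *)
  have := mz_diff tT vT tv; rewrite {}E1 uE => E1.
  have := leq_b1 (t == v ^- 9); rewrite -(leq_add2l (mz t)) -E1.
  by rewrite -addnA addSnnS leq_add2l add1n.
have [] := (dvdn_fibers (P := predC1 t) others, count_predC (pred1 t) (codom z)).
rewrite size_codom10 => D E2.
have : (mz u %| (mz t + count (predC (pred1 t)) (codom z)).+1)%N.
  by rewrite -addSn -uE dvdn_addr.
rewrite E2.
move/(primeP (isT : prime 11)).2; rewrite uE eqSS => /orP[]/eqP mt.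
  by move: tT; rewrite -mz_gt0 mt.
by have := count_size (pred1 u) (codom z); rewrite size_codom10 uE mt.
Qed.

Lemma prod_fibers m : {in T, forall t, mz t = m} -> (\prod_(t <- T) t) ^+ m = 1.
Proof.
move=> H; transitivity (\prod_(t <- codom z) t); last first.
  by rewrite codomE big_map big_enum prod_z.
rewrite -[RHS]big_undup_iterop_count -prodrXl big_seq [RHS]big_seq.
by apply: eq_bigr => t tT; rewrite H // Monoid.iteropE iter_mulr_1.
Qed.

Lemma undup_size m : {in T, forall t, mz t = m} -> (size T * m = 10)%N.
Proof.
move=> H; transitivity (size (codom z)); last exact: size_codom10.
rewrite -[RHS]count_predT -sum1_count -big_undup_iterop_count.
rewrite big_seq (eq_bigr (fun=> m)) => [|t tT].
  by rewrite -big_seq big_const_seq count_predT iter_addn_0 mulnC.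
by rewrite Monoid.iteropE H // iter_addn_0 mul1n.
Qed.

(* All [z j] are roots of X^10 - S X^9 + K X^8 - 1, where S and K are the sums
   of the [z j] and of the [w i]; were they distinct, their product would be
   -1. *)
Lemma not_all_distinct : ~ {in T, forall t, mz t = 1%N}.
Proof.
move=> H; have z_uniq : uniq (codom z).
  apply: count_mem_uniq => t; rewrite -mem_undup.
  by case: (boolP (t \in T)) => [/H //|]; rewrite -mz_gt0 lt0n negbK => /eqP.
pose S := \sum_j z j; pose K := \sum_i w i.
pose p := Poly [:: -1; 0; 0; 0; 0; 0; 0; 0; K; - S; 1].
have pE : p = [:: -1; 0; 0; 0; 0; 0; 0; 0; K; - S; 1] :> seq F.
  by apply: (@PolyK _ 0); rewrite /= oner_neq0.
have root_p j : root p (z j).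
  have zj := z_neq0 j; have [q q_inj qE] := star_perm j.
  have -> : root p (z j) = (z j ^+ 10 - S * z j ^+ 9 + K * z j ^+ 8 - 1 == 0).
    by rewrite /root horner_Poly /=; congr (_ == 0); ring.
  (* Sum w over the star at j: the missing colour gives z_j^-8, the edges give z_j z_k. *)
  have -> : K = z j ^- 8 + z j * (S - z j).
    rewrite /K (reindex_inj q_inj) /= (bigD1 j) //= (star_missing q_inj qE).
    congr (_ + _); rewrite [S](bigD1 j) //= [z j + _]addrC addrK mulr_sumr.
    by apply: eq_bigr => k kj; rewrite qE 1?eq_sym // mul_z // eq_sym.
  by apply/eqP; field.
have /(congr1 (horner^~ 0)) : p = lead_coef p *: \prod_(t <- codom z) ('X - t%:P).
  apply: all_roots_prod_XsubC; first by rewrite pE size_codom10.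
    by apply/allP => _ /codomP[j ->].
  by rewrite uniq_rootsE.
rewrite lead_coefE pE /= scale1r horner_prod codomE big_map big_enum /=.
rewrite (eq_bigr (fun j => - z j)) => [|j _]; last by rewrite !hornerE ?sub0r ?add0r.
rewrite prodrN cardT size_enum_ord prod_z -signr_odd /= expr0 mul1r.
rewrite horner_Poly /= mulr0 add0r => /eqP; rewrite eq_sym -subr_eq0 opprK.
by rewrite (negPf (two_neq0 : 1 + 1 != 0)).
Qed.

(* The colours of value t^2 match up the fibre of t perfectly. *)
Lemma mz_even t : t \in T -> t ^+ 10 != 1 -> (1 < mz t)%N -> ~~ odd (mz t).
Proof.
move=> tT t10 mt; have t0 := T_neq0 tT.
have t2 : t ^+ 2 == t ^- 8 = false.
  apply: contraNF t10 => /eqP E.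
  by rewrite (exprD t 2 8) E mulVf ?expf_neq0.
have [i wi] : exists i, w i = t ^+ 2.
  have := star_count (t ^+ 2) tT; rewrite eqxx t2 [t ^+ 2 / t]mulfK // addn0 => E.
  have : (0 < mw (t ^+ 2))%N by rewrite -(ltn_add2r 1) E.
  by rewrite -has_count has_pred1 => /codomP[i ->]; exists i.
(* The edges of colour i inside the fibre of t. As t^2 differs from t^-8, colour i is not missing at
   a vertex of the fibre, and its edge there ends in the fibre: the degree is one on the fibre and
   zero elsewhere. *)
pose r j k := [&& z j == t, z k == t, j != k & c j k == i].
have -> : mz t = (\sum_j \sum_k r j k)%N.
  rewrite count_codom; apply: eq_bigr => j _; rewrite /r; case: eqP => zj /=.
    have [p p_inj pE] := star_perm j.
    have /codomP[k ik] : i \in codom p by exact: (inj_card_onto p_inj).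
    have jk : j != k.
      apply: contraFneq t2 => jk.
      by rewrite -wi ik -jk (star_missing p_inj pE) zj.
    have zk : z k = t.
      by apply: (mulfI t0); rewrite -{1}zj mul_z // -pE // -ik wi.
    rewrite (bigD1 k) //= zk eqxx jk -pE // -ik eqxx /= big1 // => l lk.
    case: (eqVneq j l) => [|jl] /=; first by rewrite andbF.
    by rewrite -pE // ik (inj_eq p_inj) (negPf lk) andbF.
  by rewrite big1.
apply: sum_sym_even => [j k|j]; last by rewrite /r eqxx !andbF.
by rewrite /r andbCA [c j k]c_sym [j == k]eq_sym.
Qed.

Lemma mz_size5 t : t \in T -> mz t = 5%N -> t ^+ 10 = 1.
Proof. by move=> tT mt; apply/eqP; apply: contraT => /(mz_even tT); rewrite mt; apply. Qed.

(** There would be two values t, u with (t u)^5 = 1, and t^10 = u^10 = 1 since 5 is odd. Comparing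
    [star_count] at s = t^2 from t and from u puts t^2 / u in {t, u}, so t = - u; then (t u)^5 = -
    u^10 = -1. *)
Lemma not_all_fibers5 : ~ {in T, forall t, mz t = 5%N}.
Proof.
move=> H; have := undup_size H; have := prod_fibers H.
have := undup_uniq (codom z).
case ET : T => [|t [|u [|]]] //=; rewrite inE andbT !big_cons big_nil mulr1 => tu E _.
have tT : t \in T by rewrite ET inE eqxx.
have uT : u \in T by rewrite ET !inE eqxx orbT.
have t0 := T_neq0 tT; have u0 := T_neq0 uT.
have t10 := mz_size5 tT (H t tT); have u10 := mz_size5 uT (H u uT).
have t2 : t ^- 8 = t ^+ 2 by rewrite -[LHS]mul1r -t10; field.
have u2 : u ^- 8 = u ^+ 2 by rewrite -[LHS]mul1r -u10; field.
have := star_count (t ^+ 2) uT; have := star_count (t ^+ 2) tT.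
rewrite t2 u2 => /addIn-> /addIn; rewrite [t ^+ 2 / t]mulfK // H //.
move=> m5; have : t ^+ 2 / u \in T by rewrite -mz_gt0 -m5.
rewrite ET !inE => /orP[]; rewrite -(inj_eq (mulIf u0)) divfK // => /eqP.
  by move/(mulfI t0) => tu'; rewrite tu' eqxx in tu.
move/eqP; rewrite -expr2 eqf_sqr (negPf tu) /= => /eqP tu'.
move: E; rewrite tu' mulNr exprNn -signr_odd /= mulN1r -expr2 -exprM u10.
move/eqP; rewrite -subr_eq0 -opprD oppr_eq0.
by rewrite (negPf (two_neq0 : 1 + 1 != 0)).
Qed.

(** If t^10 != 1, every value other than t and - t has square t^-8, so there are at most four
    values, whereas fibres of size two require five. *)
Lemma fibers2_pow10 : {in T, forall t, mz t = 2%N} ->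
  {in T, forall t, t ^+ 10 = 1}.
Proof.
move=> H.
have mz02 s : mz s = 0%N \/ mz s = 2%N.
  by case: (boolP (s \in T)) => [/H|]; [right|rewrite -mz_gt0 lt0n negbK => /eqP; left].
have T5 : size T = 5%N by have := undup_size H; lia.
have pow_iff (x : F) : x != 0 -> (x ^+ 2 == x ^- 8) = (x ^+ 10 == 1).
  move=> x0; rewrite -(inj_eq (mulIf (expf_neq0 8 x0))) mulVf ?expf_neq0 //.
  by rewrite -exprD.
move=> t tT; apply/eqP; apply: contraT => t10; have t0 := T_neq0 tT.
(* From x, the value x^2 has multiplicity one in w. All multiplicities in z are even, so seen from y
   exactly one of the two indicators of [star_count] is 1. *)
have step x y : x \in T -> x ^+ 10 != 1 -> y \in T -> x != y ->
    (x ^+ 2 == y ^+ 2) (+) (x ^+ 2 == y ^- 8).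
  move=> xT x10 yT xy; have x0 := T_neq0 xT.
  have := star_count (x ^+ 2) yT; have := star_count (x ^+ 2) xT.
  rewrite eqxx [x ^+ 2 / x]mulfK // H // pow_iff // (negPf x10) addn0.
  rewrite addn1 => -[->].
  by case: (mz02 (x ^+ 2 / y)) => ->; do 2![case: eqP => _].
have far u : u \in T -> u != t -> u != - t ->
    [/\ u ^+ 10 != 1, t ^+ 2 = u ^- 8 & u ^+ 2 = t ^- 8].
  move=> uT ut unt; have u0 := T_neq0 uT.
  have tu2 : (t ^+ 2 == u ^+ 2) = false.
    by rewrite eq_sym eqf_sqr (negPf ut) (negPf unt).
  have tu : t != u by rewrite eq_sym.
  have := step t u tT t10 uT tu; rewrite tu2 /= => /eqP tu8.
  have u10 : u ^+ 10 != 1 by rewrite -pow_iff // -tu8 eq_sym tu2.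
  by have := step u t uT u10 tT ut; rewrite eq_sym tu2 /= => /eqP.
have farP u v : u \in T -> u != t -> u != - t -> v \in T -> v != t -> v != - t ->
    v = u \/ v = - u.
  move=> uT ut unt vT vt vnt.
  have [u10 tu8 ut8] := far u uT ut unt; have [v10 tv8 vt8] := far v vT vt vnt.
  have /eqP : v ^+ 2 = u ^+ 2 by rewrite ut8.
  by rewrite eqf_sqr => /orP[]/eqP; [left|right].
suff [u /(uniq_leq_size (undup_uniq _))] :
  exists u, {subset T <= [:: t; - t; u; - u]} by rewrite T5.
have [/allP sub|/allPn[u uT]] := boolP (all (mem [:: t; - t]) T).
  by exists t => v /sub; rewrite !inE => /orP[]->; rewrite ?orbT.
rewrite !inE negb_or => /andP[ut unt]; exists u => v vT; rewrite !inE.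
case: eqVneq => //= vt; case: eqVneq => //= vnt.
by case: (farP u v uT ut unt vT vt vnt) => ->; rewrite eqxx ?orbT.
Qed.

(** With all tenth powers equal to 1 the corrections in [star_count] cancel, so mw s = mz (s / t)
    for every t in [T]. Hence [T] is stable under multiplication by t / u, and comparing products
    over its five elements gives t^5 = u^5. Each w_i is a product of two elements of [T], so its
    fifth power is a tenth power. *)
Lemma fibers2_w : {in T, forall t, mz t = 2%N} ->
  forall i, w i ^+ 5 = 1 /\ mw (w i) = 2%N.
Proof.
move=> H i; have T10 := fibers2_pow10 H.
have T8 x : x \in T -> x ^- 8 = x ^+ 2.
  by move=> xT; rewrite -[LHS]mul1r -(T10 x xT); field; exact: T_neq0.
have mwE t s : t \in T -> mw s = mz (s / t).
  by move=> tT; have := star_count s tT; rewrite T8 // => /addIn.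
have pow5 t u : t \in T -> u \in T -> t ^+ 5 = u ^+ 5.
  move=> tT uT; have t0 := T_neq0 tT; have u0 := T_neq0 uT.
  have sub : {subset [seq x * (t / u) | x <- T] <= T}.
    move=> _ /mapP[x xT ->]; rewrite -mz_gt0 mulrA -mwE // (mwE t) // mulfK //.
    by rewrite mz_gt0.
  have tu_inj : injective ( *%R^~ (t / u)).
    by apply: mulIf; rewrite mulf_neq0 // invr_eq0.
  have uq : uniq [seq x * (t / u) | x <- T] by rewrite map_inj_uniq ?undup_uniq.
  have [_ eqT] := uniq_min_size uq sub (eq_leq (esym (size_map _ _))).
  have Tperm : perm_eq [seq x * (t / u) | x <- T] T.
    by apply: uniq_perm; rewrite ?undup_uniq.
  have prodT0 : \prod_(x <- T) x != 0.
    apply: contra_eq_neq (prod_fibers H) => ->.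
    by rewrite expr0n eq_sym oner_neq0.
  have : \prod_(x <- [seq x * (t / u) | x <- T]) x = \prod_(x <- T) x.
    exact: perm_big.
  rewrite big_map big_split /= big_const_seq count_predT.
  rewrite (_ : size T = 5%N); last by have := undup_size H; lia.
  rewrite iter_mulr_1 -[RHS]mulr1 => /(mulfI prodT0) tu5.
  by rewrite -[t](divfK u0) exprMn tu5 mul1r.
have tT := mem_T ord0; have t0 := T_neq0 tT; set t := z ord0 in tT t0.
have wiT : w i / t \in T by rewrite -mz_gt0 -mwE // -has_count has_pred1 codom_f.
split; last by rewrite (mwE t) // H.
by rewrite -[w i](divfK t0) exprMn (pow5 _ t wiT tT) -exprD T10.
Qed.

(* At s = t u, [star_count] makes all values of [z] equally frequent, so there are 1, 2, 5
   or 10 of them. *)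
Lemma product_coloring :
  (exists t, forall j, z j = t /\ w j = t ^+ 2) \/
  (forall i, w i ^+ 5 = 1 /\ count_mem (w i) (codom w) = 2%N).
Proof.
have H : {in T, forall t, mz t = mz (z ord0)}.
  by move=> t tT; apply: mz_const; rewrite ?mem_T.
have : (mz (z ord0) %| 10)%N by apply/dvdnP; exists (size T); rewrite undup_size.
rewrite dvdn_divisors // (_ : divisors 10 = [:: 1; 2; 5; 10]%N) // !inE => /or4P[] /eqP m.
- by case: not_all_distinct => t /H; rewrite m.
- by right; apply: fibers2_w => t /H; rewrite m.
- by case: not_all_fibers5 => t /H; rewrite m.
left; exists (z ord0).
have zE j : z j = z ord0.
  have : mz (z ord0) == size (codom z) by rewrite m size_codom10.
  by rewrite -all_count => /allP/(_ (z j) (codom_f _ _))/eqP.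
have t10 : z ord0 ^+ 10 = 1.
  by rewrite -prod_z (eq_bigr (fun=> z ord0)) ?prodr_const ?card_ord.
have z0 := z_neq0 ord0.
have := star_count (z ord0 ^+ 2) (mem_T ord0).
have -> : z ord0 ^- 8 = z ord0 ^+ 2 by rewrite -[LHS]mul1r -t10; field.
rewrite [z ord0 ^+ 2 / z ord0]mulfK // => /addIn; rewrite m => mw10 j; split => //.
have : mw (z ord0 ^+ 2) == size (codom w) by rewrite mw10 size_codom card_ord.
by rewrite -all_count => /allP/(_ (w j) (codom_f _ _))/eqP.
Qed.

End ProductColoring.

(** * Five-element sets with product one *)

(** Exhaustive search for a clique of size n: choose its earliest member x in the list and continue
    among the later neighbours of x. At n = 0 the empty clique exists, whence [false]. *)
Fixpoint clique_free (T : Type) (e : rel T) (n : nat) (l : seq T) : bool :=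
  if n is m.+1 then
    (fix loop (l : seq T) : bool :=
      if l is x :: l' then clique_free e m [seq y <- l' | e x y] && loop l'
      else true) l
  else false.

Lemma clique_freeP (T : eqType) (e : rel T) (n : nat) (l s : seq T) :
  clique_free e n l -> uniq s -> {subset s <= l} ->
  {in s &, forall x y, x != y -> e x y} -> (size s < n)%N.
Proof.
elim: n l s => // n IHn; elim=> [|x l IHl] s.
  by case: s => // y s _ _ /(_ y); rewrite inE eqxx => /(_ isT).
move=> /andP[free_x free_l] s_uniq s_sub s_e.
have [xs|xs] := boolP (x \in s); last first.
  apply: IHl => // y ys; have := s_sub y ys; rewrite inE => /orP[/eqP yx|//].
  by rewrite -yx ys in xs.
have := perm_to_rem xs => /perm_size -> /=; rewrite ltnS.
apply: IHn free_x (rem_uniq _ s_uniq) _ _ => [y|y y'].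
  rewrite mem_rem_uniq // inE mem_filter => /andP[yx ys].
  have := s_sub y ys; rewrite inE (negPf yx) /= => ->.
  by rewrite s_e // eq_sym.
by move=> /mem_rem ys /mem_rem y's; exact: s_e.
Qed.

Definition dotb (a b : bitseq) : nat := sumn [seq (p.1 && p.2 : nat) | p <- zip a b].

Definition wsum (a : bitseq) (t : seq nat) : nat :=
  sumn [seq (nat_of_bool p.1 * p.2)%N | p <- zip a t].

(* Discrete logarithms of the values of [w], with the points of a fibre listed
   next to each other. *)
Definition kvals : seq nat := [:: 0; 0; 1; 1; 2; 2; 3; 3; 4; 4]%N.

Fixpoint bitseqs (n : nat) : seq bitseq :=
  if n is m.+1 then [seq true :: b | b <- bitseqs m] ++ [seq false :: b | b <- bitseqs m]
  else [:: [::]].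

Lemma mem_bitseqs (b : bitseq) : b \in bitseqs (size b).
Proof.
elim: b => // x b IH /=; rewrite mem_cat.
by case: x; rewrite map_f ?orbT.
Qed.

(* Passing to the complement if necessary, one may assume that each set contains
   the first point. *)
Definition candidates : seq bitseq :=
  [seq true :: b | b <- bitseqs 9 &
    (count id (true :: b) == 5) && (5 %| wsum (true :: b) kvals)%N].

Definition meets23 (a b : bitseq) : bool := (dotb a b == 2) || (dotb a b == 3).

(** Decided by running the search; 11 is one more than the bound to be proved. *)
Lemma candidates_clique_free : clique_free meets23 11 candidates.
Proof. by vm_compute. Qed.

Section Bits.
Variables (I : finType) (p : seq I).
(** The points are read in the order [p], which can later be chosen to sort them by the discrete
    logarithm of w. *)
Definition bits (D : {set I}) : bitseq := [seq i \in D | i <- p].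
Hypothesis p_perm : perm_eq p (enum I).

Lemma bits_inj : injective bits.
Proof.
move=> D E /eq_in_map DE; apply/setP => i; apply: DE.
by rewrite (perm_mem p_perm) mem_enum.
Qed.

Lemma dotb_bits D E : dotb (bits D) (bits E) = #|D :&: E|.
Proof.
rewrite -sum1_card big_mkcond -big_enum -(perm_big _ p_perm) /=.
rewrite /dotb /bits; elim: (p) => [|i q IH] /=; first by rewrite big_nil.
by rewrite big_cons -IH inE; case: ifP.
Qed.

Lemma count_bits D : count id (bits D) = #|D|.
Proof.
rewrite -sum1_card big_mkcond -big_enum -(perm_big _ p_perm) /=.
rewrite /bits; elim: (p) => [|i q IH] /=; first by rewrite big_nil.
by rewrite big_cons -IH; case: ifP.
Qed.

Lemma wsum_bits (F : fieldType) (x : F) (w : I -> F) (k : I -> nat) (D : {set I}) :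
  (forall i, w i = x ^+ k i) -> \prod_(i in D) w i = x ^+ wsum (bits D) (map k p).
Proof.
move=> wE; rewrite big_mkcond -big_enum -(perm_big _ p_perm) /=.
rewrite /wsum /bits; elim: (p) => [|i q IH] /=; first by rewrite big_nil.
rewrite big_cons IH exprD wE; case: ifP => _; by rewrite ?mul1n ?mul0n.
Qed.

End Bits.

(** After sorting the points by discrete logarithm and replacing sets by complements where
    necessary, the sets become a clique of [candidates], to which the search applies. *)
Lemma card_fibers2_le10 (F : fieldType) (w : 'I_10 -> F) (DD : {set {set 'I_10}}) :
  (forall i, w i ^+ 5 = 1 /\ count_mem (w i) (codom w) = 2%N) ->
  \prod_i w i = 1 ->
  {in DD, forall D : {set 'I_10}, #|D| = 5%N /\ \prod_(i in D) w i = 1} ->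
  {in DD &, forall D E : {set 'I_10}, D != E -> #|D :&: E| = 2%N \/ #|D :&: E| = 3%N} ->
  (#|DD| <= 10)%N.
Proof.
move=> wP prod_w DD5 DD23.
have [x [k [x_prim wE kE]]] : exists x : F, exists k : 'I_10 -> nat,
    [/\ 5.-primitive_root x, forall i, w i = x ^+ k i &
        perm_eq [seq k i | i <- enum 'I_10] kvals].
  (* The value 1 is taken only twice. Any other value is a primitive fifth root of unity, and all
     w_j are powers of it. *)
  have [i wi] : exists i, w i != 1.
    apply/existsP; rewrite -negb_forall; apply: contraPN (wP ord0) => /forallP w1.
    have w1' j : w j = 1 by apply/eqP.
    have : all (pred1 1) (codom w) by apply/allP => _ /codomP[j ->]; apply/eqP.
    by rewrite all_count size_codom card_ord w1' => /eqP-> [].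
  have [m m_prim m5] := prim_order_exists (isT : 0 < 5)%N (wP i).1.
  have {m5} m5 : m = 5%N.
    move/(primeP (isT : prime 5)).2: m5 => /orP[]/eqP // m1.
    by move: m_prim wi; rewrite m1 => /prim_expr_order; rewrite expr1 => ->; rewrite eqxx.
  rewrite {}m5 in m_prim.
  have kex j : exists k : 'I_5, w j = w i ^+ k.
    by have [k ->] := prim_rootP m_prim (wP j).1; exists k.
  have [k kE] := fin_all_exists kex.
  exists (w i), (fun j => nat_of_ord (k j)); split => //.
  (* Five exponents, each used at most twice, cover ten points; so each is used exactly twice. *)
  have cnt (v : 'I_5) : (count_mem (nat_of_ord v) [seq nat_of_ord (k j) | j <- enum 'I_10] <= 2)%N.
    have [/mapP[j _ vj]|] := boolP (nat_of_ord v \in [seq nat_of_ord (k j) | j <- enum 'I_10]); last first.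
      by move/count_memPn->.
    apply: leq_trans (eq_leq (wP j).2); rewrite vj codomE !count_map; apply: eq_leq; apply: eq_count => l /=.
    by rewrite (kE l) (kE j) (eq_prim_root_expr m_prim) !modn_small.
  have : (\sum_(v < 5) count_mem (nat_of_ord v) [seq nat_of_ord (k j) | j <- enum 'I_10] = 10)%N.
    under eq_bigr do rewrite count_map -sum1_count big_mkcond.
    rewrite exchange_big /= big_enum; transitivity #|'I_10|; last exact: card_ord.
    rewrite -sum1_card; apply: eq_bigr => j _; rewrite (bigD1 (k j)) //= eqxx big1 ?addn0 //.
    by move=> v vk; rewrite ifN // eq_sym.
  have := (cnt (inord 0), cnt (inord 1), cnt (inord 2), cnt (inord 3), cnt (inord 4)).
  rewrite !inordK // !big_ord_recl big_ord0 /= /bump /= !addn0 !add1n.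
  set ks := [seq _ | _ <- _] => -[[[[c0 c1] c2] c3] c4] c_sum.
  have cnt2 v : (v < 5)%N -> count_mem v ks == count_mem v kvals.
    by case: v => [|[|[|[|[|]]]]] // _; apply/eqP; rewrite /=; lia.
  apply/allP => v; rewrite mem_cat => /orP[/mapP[j _ ->]|].
    exact: cnt2.
  by rewrite !inE => vk; apply: cnt2; lia.
pose p := sort (relpre k leq) (enum 'I_10).
have p_perm : perm_eq p (enum 'I_10) by rewrite perm_sort.
have kp : map k p = kvals.
  rewrite /p -sort_map; have -> : kvals = sort leq kvals by [].
  by apply/perm_sortP => //; [exact: leq_total|exact: leq_trans|exact: anti_leq].
pose i0 := head ord0 p.
have pE : p = i0 :: behead p.
  by move/perm_size: (p_perm); rewrite /i0; case: (p); rewrite ?size_enum_ord.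
pose N (D : {set 'I_10}) := if i0 \in D then D else ~: D.
have i0N D : i0 \in N D by rewrite /N; case: ifP => // /negbT; rewrite inE.
have N5 D : D \in DD -> #|N D| = 5%N /\ \prod_(i in N D) w i = 1.
  move=> /DD5[D5 prod_D]; rewrite /N; case: ifP => // _; split.
    by have := cardsC D; rewrite D5 card_ord; lia.
  have := prod_w; rewrite (bigID (fun i => i \in D)) /= prod_D mul1r.
  by under eq_bigl do rewrite -in_setC.
(* Complementing one of two five-sets exchanges intersection sizes 2 and 3; complementing both
   preserves the size. *)
have N23 D E : D \in DD -> E \in DD -> D != E -> #|N D :&: N E| = 2%N \/ #|N D :&: N E| = 3%N.
  move=> DDD EDD DE; have [D5 _] := DD5 D DDD; have [E5 _] := DD5 E EDD.
  have := DD23 D E DDD EDD DE.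
  have cID (A B : {set 'I_10}) : (#|A :&: B| + #|A :&: ~: B| = #|A|)%N.
    by rewrite -setDE cardsID.
  have := cID (~: D) E; have := cID E D; have := cID D E; have := cardsC D.
  rewrite card_ord D5 E5 [E :&: D]setIC [E :&: ~: D]setIC /N.
  by case: ifP; case: ifP => _ _; lia.
pose s := [seq bits p (N D) | D <- enum DD].
(* Distinct sets with the same normal form would give an intersection of size 5. *)
have Ninj : {in enum DD &, injective (fun D => bits p (N D))}.
  move=> D E; rewrite !mem_enum => DDD EDD /(bits_inj p_perm) NDE.
  apply/eqP; apply: contraT => DE; have := N23 D E DDD EDD DE.
  by rewrite NDE setIid; have [-> _] := N5 E EDD; case.
rewrite cardE -(size_map (fun D => bits p (N D))) -ltnS.
apply: (clique_freeP candidates_clique_free).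
- by rewrite map_inj_in_uniq // enum_uniq.
- move=> _ /mapP[D DDD ->]; rewrite mem_enum in DDD.
  have [D5 prod_D] := N5 D DDD.
  have bE : bits p (N D) = true :: [seq i \in N D | i <- behead p].
    by rewrite /bits {1}pE /= i0N.
  have sz : size [seq i \in N D | i <- behead p] = 9%N.
    by rewrite size_map size_behead (perm_size p_perm) size_enum_ord.
  have mb : [seq i \in N D | i <- behead p] \in bitseqs 9.
    by have := mem_bitseqs [seq i \in N D | i <- behead p]; rewrite sz.
  rewrite bE; apply: map_f; rewrite mem_filter mb andbT -bE (count_bits p_perm) D5.
  rewrite eqxx andTb (prim_order_dvd x_prim).
  by rewrite -kp -(wsum_bits p_perm (N D) wE) prod_D.
move=> _ _ /mapP[D DDD ->] /mapP[E EDD ->] neq; rewrite !mem_enum in DDD EDD.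
have DE : D != E by apply: contraNneq neq => ->.
rewrite /meets23 dotb_bits //; have [->|->] := N23 D E DDD EDD DE; by rewrite ?orbT.
Qed.

(** * The group R/Z inside the complex numbers *)

Section UnitCircle.
Variable R : realType.

Definition circ (x : R) : R[i] := (cos (2 * trigo.pi * x) +i* sin (2 * trigo.pi * x))%C.

Lemma circD x y : circ (x + y) = circ x * circ y.
Proof.
apply/eqP; rewrite eq_complex /= mulrDr cosD sinD eqxx /=.
by apply/eqP; ring.
Qed.

Lemma circ0 : circ 0 = 1.
Proof. by rewrite /circ mulr0 cos0 sin0. Qed.

Lemma circ_half : circ (1 / 2) = - 1.
Proof.
rewrite /circ (_ : 2 * trigo.pi * (1 / 2) = trigo.pi) ?cospi ?sinpi; last by field.
by apply/eqP; rewrite eq_complex /= oppr0 !eqxx.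
Qed.

Lemma circ_neq0 x : circ x != 0.
Proof.
apply: contra_eq_neq circ0 => x0.
by rewrite -(subrr x) circD x0 mul0r eq_sym oner_neq0.
Qed.

Lemma circN x : circ (- x) = (circ x)^-1.
Proof.
apply: (mulfI (circ_neq0 x)).
by rewrite -circD subrr circ0 divff ?circ_neq0.
Qed.

Lemma circ1 : circ 1 = 1.
Proof.
by rewrite (_ : 1 = 1 / 2 + 1 / 2) ?circD ?circ_half ?mulrNN ?mulr1 //; field.
Qed.

Lemma circ_int x : x \is a Num.int -> circ x = 1.
Proof.
have circ_nat n : circ n%:R = 1.
  by elim: n => [|n IH]; rewrite ?circ0 // -natr1 circD IH circ1 mulr1.
by case/intrP => -[] n ->; rewrite ?NegzE ?mulrNz ?circN -?pmulrn circ_nat ?invr1.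
Qed.

(** For the fractional part y, cos (2 pi y) = 1 - 2 sin^2 (pi y), and sin (pi y) > 0 when 0 < y <
    1. *)
Lemma circ_eq1 x : circ x = 1 -> x \is a Num.int.
Proof.
move=> x1; pose y := x - (Num.floor x)%:~R.
have y1 : circ y = 1 by rewrite circD x1 mul1r circ_int // rpredN intr_int.
have y_ge0 : 0 <= y by rewrite subr_ge0 floor_le.
have y_lt1 : y < 1 by have := floorD1_gt x; rewrite rmorphD /= /y; lra.
have [y0|y0] := eqVneq y 0.
  by move/eqP: y0; rewrite subr_eq0 => /eqP->; rewrite intr_int.
have y_gt0 : 0 < y by rewrite lt_neqAle eq_sym y0.
have : 0 < sin (trigo.pi * y).
  by apply: sin_gt0_pi; rewrite mulr_gt0 ?pi_gt0 //= gtr_pMr ?pi_gt0.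
have /(congr1 (@complex.Re R)) /= := y1.
rewrite (_ : 2 * trigo.pi * y = trigo.pi * y + trigo.pi * y); last by ring.
rewrite cosD => E; have := cos2Dsin2 (trigo.pi * y); rewrite !expr2 => E2 s_gt0.
by have := mulr_gt0 s_gt0 s_gt0; lra.
Qed.

Lemma circ_sum (I : Type) (r : seq I) (P : pred I) (f : I -> R) :
  circ (\sum_(i <- r | P i) f i) = \prod_(i <- r | P i) circ (f i).
Proof. by rewrite (big_morph circ circD circ0). Qed.

End UnitCircle.

(** * Short vectors of the dual lattice *)

Section ShortVectors.
Variable R : realType.

Lemma sum_indicator (D : {set 'I_10}) : \sum_i (i \in D)%:R = #|D|%:R :> R.
Proof. by rewrite -natr_sum -big_mkcond sum1_card. Qed.

(** Such b form the dual lattice of A_9. The residue n of 10 b_0 modulo 10 is the class of b modulo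
    A_9, and n (10 - n) / 10 is the minimal norm in that class, as c^2 - c >= 0 for integers. *)
Lemma int_coset10 (b : 'I_10 -> R) : \sum_j b j = 0 ->
    (forall j, b j - b ord0 \is a Num.int) ->
  exists (n : nat) (c : 'I_10 -> int),
    [/\ (n < 10)%N, forall j, b j = n%:R / 10 - (c j)%:~R, \sum_j c j = n%:Z &
        \sum_j b j ^+ 2 = (\sum_j (c j ^+ 2 - c j))%:~R + (n * (10 - n))%:R / 10].
Proof.
move=> b0 b_int.
have /intrP[q qE] : 10 * b ord0 \is a Num.int.
  have -> : 10 * b ord0 = - \sum_j (b j - b ord0).
    by rewrite sumrB b0 sumr_const card_ord sub0r opprK mulr_natl.
  by rewrite rpredN rpred_sum.
have [n n10 [t qt]] : exists2 n : nat, (n < 10)%N & exists t, q = n%:Z + t * 10.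
  exists `|(q %% 10)%Z|%N; first by have := ltz_pmod q (isT : 0 < 10 :> int); have := modz_ge0 q (isT : (10 : int) != 0); lia.
  by exists (q %/ 10)%Z; rewrite gez0_abs ?modz_ge0 // addrC -divz_eq.
have c_ex j : exists c, b j = n%:R / 10 - c%:~R.
  have /intrP[s sE] := b_int j; exists (- s - t).
  have b0E : b ord0 = q%:~R / 10 by rewrite -qE; field.
  by rewrite -[LHS](subrK (b ord0)) sE b0E qt !(rmorphD, rmorphB, rmorphN, rmorphM) /=; field.
have [c cE] := fin_all_exists c_ex; exists n, c.
have sum_c : \sum_j c j = n%:Z.
  have : \sum_j (n%:R / 10 - (c j)%:~R) = 0 :> R.
    by rewrite -[RHS]b0; apply: eq_bigr.
  rewrite sumrB sumr_const card_ord -mulr_natl => E.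
  apply/eqP; rewrite -(eqr_int R) rmorph_sum -pmulrn /=; apply/eqP.
  by move: E; lra.
split=> //.
have sum_cR : \sum_j (c j)%:~R = n%:R :> R.
  by have := congr1 (intr : int -> R) sum_c; rewrite rmorph_sum.
transitivity (\sum_j (b j * (n%:R / 10) - ((c j)%:~R * (n%:R / 10) - (c j)%:~R ^+ 2))).
  by apply: eq_bigr => j _; rewrite cE; ring.
rewrite sumrB -mulr_suml b0 mul0r sumrB -mulr_suml sum_cR.
rewrite sumrB rmorphB /= !rmorph_sum /= sum_cR natrM natrB 1?ltnW //.
under [X in _ = X - _ + _]eq_bigr do rewrite rmorphXn.
by rewrite /=; field.
Qed.

(* [inl (s, i, E)] stands for (-1)^s (1/10 - e_i, 1/5 - 1_E) and [inr D] for
   (1/2 - 1_D, 0), as made precise by [xc] and [yc]. *)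
Definition code := ((bool * 'I_10 * {set 'I_10}) + {set 'I_10})%type.

Definition valid (c : code) : bool :=
  match c with inl (_, _, E) => #|E| == 2 | inr D => #|D| == 5 end.

(** Membership in [[set i0]] makes every component a signed shifted indicator, so that [sum_shift2]
    serves for all inner products. *)
Definition xc (c : code) (i : 'I_10) : R :=
  match c with
  | inl (s, i0, _) => (-1) ^+ s * (1 / 10 - (i \in [set i0])%:R)
  | inr D => 1 / 2 - (i \in D)%:R
  end.

Definition yc (c : code) (j : 'I_10) : R :=
  match c with
  | inl (s, _, E) => (-1) ^+ s * (1 / 5 - (j \in E)%:R)
  | inr _ => 0
  end.

Lemma sqr_int01 (c : 'I_10 -> int) : \sum_j (c j ^+ 2 - c j) = 0 ->
  exists D : {set 'I_10}, forall j, c j = (j \in D)%:R.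
Proof.
move=> c0; exists [set j | c j == 1] => j; rewrite inE.
have c_ge0 (i : 'I_10) : true -> 0 <= c i ^+ 2 - c i.
  by move=> _; rewrite expr2; nia.
have /eqP := c0; rewrite psumr_eq0 // => /allP/(_ j (mem_index_enum _)) /= /eqP.
by case: eqP => [->//|] c1; rewrite expr2; nia.
Qed.

(** Norms are multiplied by ten. Among classes with m + 2 n = 5 modulo 10 the minimal norms add up
    to at least 25, with equality in three cases, so nothing is left for U and V. *)
Lemma glue_classes (m n : nat) (U V t : int) :
  (m < 10)%N -> (n < 10)%N -> 0 <= U -> 0 <= V -> m%:Z + 2 * n%:Z - 5 = 10 * t ->
  10 * U + 10 * V + (m * (10 - m))%:Z + (n * (10 - n))%:Z <= 25 ->
  [/\ U = 0, V = 0 & (m, n) \in [:: (5, 0); (1, 2); (9, 8)]%N].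
Proof.
rewrite !inE !xpair_eqE.
case: m => [|[|[|[|[|[|[|[|[|[|m]]]]]]]]]] // _; case: n => [|[|[|[|[|[|[|[|[|[|n]]]]]]]]]] // _; move=> *; split=> //; lia.
Qed.

Lemma short_vectors (a b : 'I_10 -> R) :
    \sum_i a i = 0 -> \sum_j b j = 0 ->
    (forall i, a i - a ord0 \is a Num.int) ->
    (forall j, b j - b ord0 \is a Num.int) ->
    a ord0 + 2 * b ord0 - 1 / 2 \is a Num.int ->
    \sum_i a i ^+ 2 + \sum_j b j ^+ 2 <= 5 / 2 ->
  exists c, [/\ valid c, a =1 xc c & b =1 yc c].
Proof.
move=> a0 b0 a_int b_int ab_int.
have [m [d [m10 aE sum_d ->]]] := int_coset10 a0 a_int.
have [n [c [n10 bE sum_c ->]]] := int_coset10 b0 b_int => short.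
have [t mn] : exists t : int, m%:Z + 2 * n%:Z - 5 = 10 * t.
  have /intrP[t tE] := ab_int; exists (t + d ord0 + 2 * c ord0).
  apply/eqP; rewrite -(eqr_int R) !(rmorphD, rmorphB, rmorphN, rmorphM) /= -tE.
  by rewrite aE bE; apply/eqP; field.
have U0 : 0 <= \sum_i (d i ^+ 2 - d i).
  by apply: sumr_ge0 => i _; rewrite expr2; nia.
have V0 : 0 <= \sum_i (c i ^+ 2 - c i).
  by apply: sumr_ge0 => i _; rewrite expr2; nia.
have {short} : 10 * (\sum_i (d i ^+ 2 - d i)) + 10 * (\sum_i (c i ^+ 2 - c i)) +
    (m * (10 - m))%:Z + (n * (10 - n))%:Z <= 25.
  by rewrite -(ler_int R) !(rmorphD, rmorphM) /=; move: short; lra.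
move: U0 V0; set U := \sum_i _; set V := \sum_i _ => U0 V0 UV.
have [U0' V0' mn'] := glue_classes m10 n10 U0 V0 mn UV.
have [D dD] := sqr_int01 U0'; have [C cC] := sqr_int01 V0'.
have cardD : #|D| = m.
  apply/eqP; rewrite -eqz_nat -sum_d; apply/eqP.
  by under eq_bigr do rewrite dD; rewrite -natr_sum -big_mkcond sum1_card natz.
have cardC : #|C| = n.
  apply/eqP; rewrite -eqz_nat -sum_c; apply/eqP.
  by under eq_bigr do rewrite cC; rewrite -natr_sum -big_mkcond sum1_card natz.
have aE' i : a i = m%:R / 10 - (i \in D)%:R by rewrite aE dD natz -pmulrn.
have bE' i : b i = n%:R / 10 - (i \in C)%:R by rewrite bE cC natz -pmulrn.
move: mn'; rewrite !inE !xpair_eqE => /or3P[] /andP[/eqP mE /eqP nE].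
- exists (inr D); split; first by rewrite /= cardD mE.
    by move=> i; rewrite aE' mE /=; field.
  by move=> j; rewrite bE' nE (cards0_eq (etrans cardC nE)) in_set0 mul0r subrr.
- have /cards1P[i0 DE] : #|D| == 1%N by rewrite cardD mE.
  exists (inl (false, i0, C)); split; first by rewrite /= cardC nE.
    by move=> i; rewrite aE' mE DE /=; field.
  by move=> j; rewrite bE' nE /=; field.
(* The class (9, 8) is the negative of (1, 2), with D and C replaced by their complements. *)
have /cards1P[i0 DE] : #|~: D| == 1%N.
  by have := cardsC D; rewrite card_ord cardD mE; lia.
exists (inl (true, i0, ~: C)); split.
- by have := cardsC C; rewrite card_ord cardC nE /=; lia.
- by move=> i; rewrite aE' mE /= -DE in_setC; case: (i \in D) => /=; field.
by move=> j; rewrite bE' nE /= in_setC; case: (j \in C) => /=; field.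
Qed.
End ShortVectors.

(** * Inner products in X *)

Section Codes.
Variable R : realType.
Implicit Types (c : code) (D E : {set 'I_10}).
Local Notation xc := (@xc R).
Local Notation yc := (@yc R).

Lemma dotv_row_mx d1 d2 (u u' : 'rV[R]_d1) (v v' : 'rV[R]_d2) :
  dotv (row_mx u v) (row_mx u' v') = dotv u u' + dotv v v'.
Proof.
rewrite /dotv big_split_ord; congr (_ + _); apply: eq_bigr => i _.
  by rewrite !row_mxEl.
by rewrite !row_mxEr.
Qed.

Lemma dotv_vec3 (x y x' y' : 'rV[R]_10) (z z' : 'rV[R]_2) :
  dotv (vec3 x y z) (vec3 x' y' z') = dotv x x' + dotv y y' + dotv z z'.
Proof. by rewrite !dotv_row_mx. Qed.

Lemma alpha1E : alpha R 1 0 ord0 = 1 / 2 /\ alpha R 1 0 ord_max = - (1 / 2).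
Proof. by rewrite !mxE /=; split; field. Qed.

Lemma dotv2 (z z' : 'rV[R]_2) :
  dotv z z' = z 0 ord0 * z' 0 ord0 + z 0 ord_max * z' 0 ord_max.
Proof.
have -> : ord_max = lift ord0 ord0 :> 'I_2 by exact: val_inj.
by rewrite /dotv !big_ord_recl big_ord0 addr0.
Qed.

Definition vec c : 'rV[R]_(10 + 10 + 2) :=
  vec3 (\row_i xc c i) (\row_i yc c i) (alpha R 1).

(** The A_1 components are left out; they always contribute 1/2. *)
Definition cdot c c' : R := \sum_i xc c i * xc c' i + \sum_i yc c i * yc c' i.

Lemma dotv_vec c c' : dotv (vec c) (vec c') = cdot c c' + 1 / 2.
Proof.
rewrite dotv_vec3 dotv2; have [-> ->] := alpha1E; congr (_ + _); last by field.
by congr (_ + _); apply: eq_bigr => i _; rewrite !mxE.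
Qed.

Lemma sum_shift (p : R) D : \sum_i (p - (i \in D)%:R) = 10 * p - #|D|%:R.
Proof. by rewrite sumrB sum_indicator sumr_const card_ord mulr_natl. Qed.

Lemma sum_shift2 (p q : R) D E :
  \sum_i (p - (i \in D)%:R) * (q - (i \in E)%:R) =
  10 * p * q - p * #|E|%:R - q * #|D|%:R + #|D :&: E|%:R.
Proof.
rewrite -!sum_indicator -mulrA mulr_natl -[in (p * q) *+ _](card_ord 10) -sumr_const.
rewrite !mulr_sumr -!sumrB -big_split; apply: eq_bigr => i _ /=.
by rewrite !inE; case: (i \in D); case: (i \in E) => /=; ring.
Qed.

Lemma card_set1I (i : 'I_10) D : #|[set i] :&: D| = (i \in D).
Proof.
case: (boolP (i \in D)) => iD.
  by rewrite (setIidPl _) ?sub1set // cards1.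
by apply/eqP; rewrite cards_eq0 setI_eq0 disjoints1.
Qed.

Lemma cdot_ll s i D s' i' D' : #|D| = 2%N -> #|D'| = 2%N ->
  cdot (inl (s, i, D)) (inl (s', i', D')) =
  (-1) ^+ s * (-1) ^+ s' * ((i == i')%:R + #|D :&: D'|%:R - 1 / 2).
Proof.
move=> D2 D2'; rewrite /cdot /=.
under eq_bigr do rewrite mulrACA; under [X in _ + X]eq_bigr do rewrite mulrACA.
rewrite -!mulr_sumr !sum_shift2 D2 D2' !cards1 -mulrDr; congr (_ * _).
have -> : #|[set i] :&: [set i']| = (i == i').
  by rewrite card_set1I in_set1.
by field.
Qed.

Lemma cdot_rr D D' : #|D| = 5%N -> #|D'| = 5%N ->
  cdot (inr D) (inr D') = #|D :&: D'|%:R - 5 / 2.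
Proof.
move=> D5 D5'; rewrite /cdot /= sum_shift2 D5 D5' big1 => [|i _]; last by rewrite mulr0.
by field.
Qed.

Lemma cdot_lr s i E D : #|D| = 5%N ->
  cdot (inl (s, i, E)) (inr D) = (-1) ^+ s * ((i \in D)%:R - 1 / 2).
Proof.
move=> D5; rewrite /cdot /= [X in _ + X]big1 => [|j _]; last by rewrite mulr0.
under eq_bigr do rewrite -mulrA.
rewrite -mulr_sumr sum_shift2 D5 cards1 addr0; congr (_ * _).
have -> : #|[set i] :&: D| = (i \in D).
  exact: card_set1I.
by field.
Qed.

Lemma cdotC c c' : cdot c c' = cdot c' c.
Proof. by rewrite /cdot; congr (_ + _); apply: eq_bigr => i _; rewrite mulrC. Qed.

Definition compatible c c' : Prop := dotv (vec c) (vec c') = 0 \/ dotv (vec c) (vec c') = 1.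

Lemma compatibleC c c' : compatible c c' -> compatible c' c.
Proof. by rewrite /compatible !dotv_vec cdotC. Qed.

Lemma signP (s : bool) : (-1) ^+ s = 1 :> R \/ (-1) ^+ s = -1 :> R.
Proof. by case: s; [right|left]. Qed.

(** With n the sum on the right, the inner product is 1/2 plus or minus (n - 1/2). The condition n
    <= 1 says that edges are not repeated and that edges of equal colour are disjoint. *)
Lemma compatible_ll s i D s' i' D' : #|D| = 2%N -> #|D'| = 2%N ->
  compatible (inl (s, i, D)) (inl (s', i', D')) <-> ((i == i') + #|D :&: D'| <= 1)%N.
Proof.
move=> D2 D2'; rewrite /compatible dotv_vec cdot_ll // -natrD.
move: ((i == i') + #|D :&: D'|)%N => n; split => [H|]; last first.
  by case: n => [|[|//]] _; case: (signP s) => ->; case: (signP s') => ->; lra.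
rewrite leqNgt; apply/negP; rewrite -(ler_nat R) => n2.
suff : 0 < 0 :> R by rewrite ltxx.
by move: H; case: (signP s) => ->; case: (signP s') => ->; case=> H; lra.
Qed.

Lemma compatible_rr D D' : #|D| = 5%N -> #|D'| = 5%N ->
  compatible (inr D) (inr D') <-> (#|D :&: D'| = 2 \/ #|D :&: D'| = 3)%N.
Proof.
move=> D5 D5'; rewrite /compatible dotv_vec cdot_rr //.
move: #|D :&: D'| => n; split=> [] [] H.
- by left; apply/eqP; rewrite -(eqr_nat R); apply/eqP; lra.
- by right; apply/eqP; rewrite -(eqr_nat R); apply/eqP; lra.
- by left; rewrite H; field.
by right; rewrite H; field.
Qed.

Lemma compatible_lr s i E D : #|D| = 5%N -> compatible (inl (s, i, E)) (inr D).
Proof.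
move=> D5; rewrite /compatible dotv_vec cdot_lr //.
by case: (signP s) => ->; case: (i \in D) => /=; lra.
Qed.

Lemma compatible_rl s i E D : #|D| = 5%N -> compatible (inr D) (inl (s, i, E)).
Proof. by move=> D5; apply/compatibleC/compatible_lr. Qed.

Lemma cdot_self c : valid c -> cdot c c = 5 / 2.
Proof.
case: c => [[[s i] D]|D] /= /eqP cD.
  by rewrite cdot_ll // setIid cD eqxx; case: (signP s) => -> /=; field.
by rewrite cdot_rr // setIid cD; field.
Qed.

(** Equality of vectors forces [cdot c c'] to be 5/2, a value reached only by equal codes. *)
Lemma vec_inj : {in valid &, injective vec}.
Proof.
move=> c c' vc vc' E; have := cdot_self vc.
have -> : cdot c c = cdot c c'.
  by apply: (addIr (1 / 2)); rewrite -!dotv_vec E.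
have [v1 v2] : valid c /\ valid c' by []; move: v1 v2 {vc vc' E}.
case: c c' => [[[s i] D]|D] [[[s' i'] D']|D'] /= /eqP cD /eqP cD'; last first.
- rewrite cdot_rr // => H; congr inr; apply/eqP; rewrite eqEcard cD cD' leqnn andbT.
  apply/setIidPl/eqP; rewrite eqEcard subsetIl cD /=.
  by rewrite -(ler_nat R); lra.
- rewrite cdotC cdot_lr // => H; suff : 0 < 0 :> R by rewrite ltxx.
  by move: H; case: (signP s') => ->; case: (_ \in _) => /=; lra.
- rewrite cdot_lr // => H; suff : 0 < 0 :> R by rewrite ltxx.
  by move: H; case: (signP s) => ->; case: (_ \in _) => /=; lra.
rewrite cdot_ll //.
have Dle : (#|D :&: D'| <= 2)%N by apply: leq_trans (subset_leq_card (subsetIl _ _)) _; rewrite cD.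
have : (#|D :&: D'|%:R <= 2 :> R) by rewrite (ler_nat R _ 2).
move=> Dle' H.
have ii : i = i'.
  apply/eqP; move: H; case: eqP => // _ H; suff : 0 < 0 :> R by rewrite ltxx.
  by move: H (ler0n R #|D :&: D'|); case: (signP s) => ->; case: (signP s') => -> /=; lra.
have DD : (2 <= #|D :&: D'|)%N.
  by rewrite -(ler_nat R); move: H (ler0n R #|D :&: D'|); rewrite ii eqxx; case: (signP s) => ->; case: (signP s') => -> /=; lra.
have -> : D = D'.
  apply/eqP; rewrite eqEcard cD cD' leqnn andbT.
  by apply/setIidPl/eqP; rewrite eqEcard subsetIl cD.
suff -> : s = s' by rewrite ii.
apply/eqP; move: H; rewrite ii eqxx; case: eqP => // ss H.
suff : 0 < 0 :> R by rewrite ltxx.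
by move: ss H (ler0n R #|D :&: D'|); case: s; case: s' => //= _; lra.
Qed.
End Codes.

(** * Description of X by codes *)

Section MemX0.
Variable R : realType.
Local Notation xc := (@xc R).
Local Notation yc := (@yc R).
Local Notation vec := (@vec R).

Lemma alphaE n i : alpha R n 0 i = n.+1%:R^-1 - (i == ord_max)%:R.
Proof.
rewrite mxE; case: eqP => _ /=; last by rewrite subr0.
by rewrite -natr1; field; rewrite natr1 pnatr_eq0.
Qed.

Lemma sum_alpha n : \sum_i alpha R n 0 i = 0.
Proof.
under eq_bigr do rewrite alphaE.
rewrite sumrB sumr_const card_ord (bigD1 ord_max) //= eqxx big1 => [|i /negPf-> //].
by rewrite addr0 -[_ *+ n.+1]mulr_natl mulfV ?subrr // pnatr_eq0.
Qed.

Lemma sub_alphaE n (x : 'rV[R]_n.+1) (s : R) i :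
  (x - s *: alpha R n) 0 i = x 0 i - s * alpha R n 0 i.
Proof. by rewrite 3!mxE. Qed.

Lemma sum_sub_alpha n (x : 'rV[R]_n.+1) (s : R) :
  \sum_i (x - s *: alpha R n) 0 i = \sum_i x 0 i.
Proof.
under eq_bigr do rewrite sub_alphaE.
by rewrite sumrB -mulr_sumr sum_alpha mulr0 subr0.
Qed.

Lemma LambdaP (x y : 'rV[R]_10) (z : 'rV[R]_2) : Lambda (vec3 x y z) <->
  exists m : int, [/\ root_lattice_A (x - m%:~R *: alpha R 9),
    root_lattice_A (y - (m%:~R * 2) *: alpha R 9) & root_lattice_A (z - m%:~R *: alpha R 1)].
Proof.
split=> [[x' [y' [z' [m [Ax Ay Az E]]]]]|[m [Ax Ay Az]]].
  exists m; move: E; rewrite -scaler_int !scale_row_mx !add_row_mx.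
  move=> /eq_row_mx[/eq_row_mx[-> ->] ->].
  by rewrite scalerA !addrK.
exists (x - m%:~R *: alpha R 9), (y - (m%:~R * 2) *: alpha R 9), (z - m%:~R *: alpha R 1), m.
split=> //.
by rewrite -scaler_int !scale_row_mx !add_row_mx scalerA !subrK.
Qed.

(** All coordinates of alpha_n are congruent to 1 / (n + 1) modulo 1. *)
Lemma sub_alpha_int n (x : 'rV[R]_n.+1) (m : int) i :
  ((x - m%:~R *: alpha R n) 0 i \is a Num.int) = (x 0 i - m%:~R / n.+1%:R \is a Num.int).
Proof.
rewrite sub_alphaE alphaE mulrBr opprB addrA addrAC rpredDr //.
by rewrite rpredM ?intr_int ?natr_int.
Qed.

Lemma int_diff (I : Type) (f : I -> R) (s : R) :
  (forall i, f i - s \is a Num.int) -> forall i j, f i - f j \is a Num.int.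
Proof.
by move=> f_int i j; rewrite -[f i](subrK s) -addrA rpredD // -opprB rpredN.
Qed.

Lemma dotv_r0 (x y : 'rV[R]_10) (z : 'rV[R]_2) :
  dotv (vec3 x y z) r0 = z 0 ord0 - z 0 ord_max.
Proof.
have dot0 d (u : 'rV[R]_d) : dotv u 0 = 0.
  by rewrite /dotv big1 // => i _; rewrite mxE mulr0.
have scE i : (2 *: alpha R 1) 0 i = 2 * alpha R 1 0 i by rewrite mxE.
rewrite /r0 dotv_vec3 !dot0 !add0r dotv2 !scE.
by have [-> ->] := alpha1E R; field.
Qed.

(** The conditions on r and on coordinate sums force z = alpha_1, so x and y satisfy the glue
    condition and have total norm 3 - 1/2, as [short_vectors] requires. *)
Lemma X0P (u : 'rV[R]_(10 + 10 + 2)) : X0 u <-> exists2 c, valid c & u = vec c.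
Proof.
split=> [[]|[c vc ->]].
  rewrite -[u]hsubmxK -[lsubmx u]hsubmxK -/(vec3 _ _ _).
  set x := lsubmx (lsubmx u); set y := rsubmx (lsubmx u); set z := rsubmx u.
  move=> /LambdaP[m [[x_int x_sum] [y_int y_sum] [z_int z_sum]]].
  rewrite dotv_r0 => norm_u z1.
  have zE : z = alpha R 1.
    have [h0 h1] := alpha1E R; apply/rowP => i.
    have : \sum_j z 0 j = 0.
      by have := z_sum; rewrite sum_sub_alpha.
    rewrite !big_ord_recl big_ord0; have -> : lift ord0 ord0 = ord_max :> 'I_2 by exact: val_inj.
    move=> z0; have [->|->] : i = ord0 \/ i = ord_max.
      by case: i => [[|[|//]] i2]; [left|right]; exact: val_inj.
      by rewrite h0; lra.
    by rewrite h1; lra.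
  (* The glue multiple m is odd because z = alpha_1. *)
  have z0_int : (1 - m%:~R) / 2 \is a @Num.int R.
    have := z_int ord0; rewrite sub_alphaE zE; have [-> _] := alpha1E R.
    by congr (_ \is a _); field.
  have x_coset i : x 0 i - m%:~R / 10 \is a Num.int by rewrite -sub_alpha_int.
  have y_coset : forall j, y 0 j - (m * 2)%:~R / 10 \is a Num.int.
    by move=> j; rewrite -sub_alpha_int rmorphM; exact: y_int.
  have [] := @short_vectors R (fun i => x 0 i) (fun j => y 0 j).
  - by move: x_sum; rewrite sum_sub_alpha.
  - by move: y_sum; rewrite sum_sub_alpha.
  - by move=> i; exact: int_diff x_coset _ _.
  - by move=> i; exact: int_diff y_coset _ _.
  - have -> : x 0 ord0 + 2 * y 0 ord0 - 1 / 2 = (x 0 ord0 - m%:~R / 10) +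
        2 * (y 0 ord0 - (m * 2)%:~R / 10) - (1 - m%:~R) / 2.
      by rewrite rmorphM /=; field.
    by rewrite rpredB // rpredD // rpredM // (natr_int R 2).
  - have [h0 h1] := alpha1E R; move: norm_u.
    rewrite dotv_vec3 dotv2 zE h0 h1 /dotv; under eq_bigr do rewrite -expr2.
    under [X in _ + X + _]eq_bigr do rewrite -expr2.
    lra.
  move=> c [vc xc_eq yc_eq]; exists c => //; rewrite /vec zE.
  by congr vec3; apply/rowP => i; rewrite mxE.
split; last first.
- by rewrite dotv_r0; have [-> ->] := alpha1E R; field.
- by rewrite dotv_vec cdot_self //; field.
(* The glue multiple is 1 or -1 for edge codes and 5 for five-sets, where 10 alpha_9 lies in A_9. *)
pose m (d : code) : int := match d with inl (s, _, _) => (-1) ^+ s | inr _ => 5 end.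
have [h0 h1] := alpha1E R.
apply/LambdaP; exists (m c); split; split.
- move=> i; rewrite sub_alpha_int mxE.
  have -> : xc c i - (m c)%:~R / 10 =
      - (match c with inl (s, i0, _) => (-1) ^+ s * (i \in [set i0])%:R | inr D => (i \in D)%:R end).
    by case: c {vc} => [[[s i0] D]|D] /=; rewrite ?rmorphXn /= ?rmorphN1; field.
  by rewrite rpredN; case: c {vc} => [[[s i0] D]|D]; rewrite ?natr_int // rpredM ?rpredX ?rpredN ?rpred1 ?natr_int.
- rewrite sum_sub_alpha; under eq_bigr do rewrite mxE.
  case: c vc => [[[s i0] D]|D] /= /eqP cD; last by rewrite sum_shift cD; field.
  by rewrite -mulr_sumr sum_shift cards1; field.
- move=> i; have <- : (m c * 2)%:~R = (m c)%:~R * 2 :> R by rewrite rmorphM.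
  rewrite sub_alpha_int mxE.
  have -> : yc c i - (m c * 2)%:~R / 10 =
      - (match c with inl (s, _, D) => (-1) ^+ s * (i \in D)%:R | inr _ => 1 end).
    by case: c {vc} => [[[s i0] D]|D] /=; rewrite rmorphM ?rmorphXn /= ?rmorphN1; field.
  by rewrite rpredN; case: c {vc} => [[[s i0] D]|D]; rewrite ?rpred1 // rpredM ?rpredX ?rpredN ?rpred1 ?natr_int.
- rewrite sum_sub_alpha; under eq_bigr do rewrite mxE.
  case: c vc => [[[s i0] D]|D] /= /eqP cD; last by rewrite big1.
  by rewrite -mulr_sumr sum_shift cD; field.
- move=> i; rewrite sub_alpha_int alphaE addrAC rpredB ?natr_int //.
  have -> : 2^-1 - (m c)%:~R / 2 =
      (match c with inl (s, _, _) => s%:R | inr _ => - 2 end) :> R.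
    by case: c {vc} => [[[[] i0] D]|D] /=; rewrite ?expr1 ?expr0 ?rmorphN1; field.
  by case: c {vc} => [[[s i0] D]|D]; rewrite ?rpredN ?natr_int.
by rewrite sum_sub_alpha sum_alpha.
Qed.
End MemX0.

(** * Maximum sets *)

Section Families.
Variable R : realType.
Local Notation vec := (@vec R).
Local Notation compatible := (@compatible R).

Definition is_compatible (V : {set code}) : Prop :=
  {in V, forall c, valid c} /\ {in V &, forall c c', c != c' -> compatible c c'}.

Definition vecs (V : {set code}) : {fset 'rV[R]_(10 + 10 + 2)} :=
  [fset v in [seq vec c | c <- enum V]]%fset.

Lemma is_root_r0 : is_root (r0 : 'rV[R]_(10 + 10 + 2)).
Proof.
rewrite /is_root {1}/r0 dotv_r0; have [h0 h1] := alpha1E R.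
have scE i : (2 *: alpha R 1) 0 i = 2 * alpha R 1 0 i by rewrite mxE.
by rewrite !scE h0 h1; field.
Qed.

Lemma vecsP (V : {set code}) u : reflect (exists2 c, c \in V & u = vec c) (u \in vecs V).
Proof.
rewrite inE /=; apply: (iffP mapP) => -[c cV ->]; exists c => //.
  by rewrite mem_enum in cV.
by rewrite mem_enum.
Qed.

Lemma vecs_equiangular (V : {set code}) : is_compatible V ->
  [/\ affine_equiangular r0 (vecs V), forall u, u \in vecs V -> X0 u & #|` vecs V| = #|V|].
Proof.
move=> [Vvalid Vcomp].
have VX u : u \in vecs V -> X0 u.
  by move=> /vecsP[c cV ->]; apply/X0P; exists c; rewrite ?Vvalid.
split=> //.
- exists 3; split; first exact: is_root_r0.
    by move=> u /VX[_ -> ->].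
  move=> _ _ /vecsP[c cV ->] /vecsP[c' cV' ->] neq; apply: Vcomp => //.
  by apply: contraNneq neq => ->.
rewrite card_fseq undup_id ?size_map -?cardE // map_inj_in_uniq ?enum_uniq // => c c'.
by rewrite !mem_enum => cV cV'; apply: vec_inj; exact: Vvalid.
Qed.

Definition pairs : {set {set 'I_10}} := [set E : {set 'I_10} | #|E| == 2].

Lemma card_pairs : #|pairs| = 45%N.
Proof. by rewrite card_draws card_ord. Qed.

Definition sum_colour (E : {set 'I_10}) : 'I_10 := inord ((\sum_(x in E) x) %% 10)%N.

Definition complete_family : {set code} :=
  [set (inl (false, sum_colour E, E) : code) | E in pairs].

Lemma card_complete_family : #|complete_family| = 45%N.
Proof. by rewrite card_imset ?card_pairs // => E E' []. Qed.

(** Distinct edges share at most one vertex, and cancelling a shared vertex from equal sums modulo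
    10 makes the edges equal. *)
Lemma sum_colour_proper (E E' : {set 'I_10}) : #|E| = 2%N -> #|E'| = 2%N -> E != E' ->
  ((sum_colour E == sum_colour E') + #|E :&: E'| <= 1)%N.
Proof.
move=> E2 E2' neq.
have : (#|E :&: E'| <= 1)%N.
  rewrite leqNgt; apply: contra neq => EE.
  rewrite eqEcard E2 E2' leqnn andbT; apply/setIidPl/eqP.
  by rewrite eqEcard subsetIl E2.
case card1: #|E :&: E'| => [|[|//]] _; first by rewrite addn0 leq_b1.
case: eqP => // /(congr1 val); rewrite /= !inordK ?ltn_mod // => sumE.
have /cards1P[x EEx] : #|E :&: E'| == 1%N by rewrite card1.
have : x \in E :&: E' by rewrite EEx inE.
rewrite inE => /andP[xE xE'].
have /cards1P[y Ey] : #|E :\ x| == 1%N by move: E2; rewrite (cardsD1 x) xE; lia.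
have /cards1P[y' Ey'] : #|E' :\ x| == 1%N by move: E2'; rewrite (cardsD1 x) xE'; lia.
move: sumE; rewrite (big_setD1 x xE) (big_setD1 x xE') /= Ey Ey' !big_set1 => /eqP.
rewrite eqn_modDl !modn_small // => /eqP/val_inj yy.
by case/eqP: neq; rewrite -(setD1K xE) -(setD1K xE') Ey Ey' yy.
Qed.

(* Found by computer search. *)
Definition halves : seq bitseq := [seq [seq (i \in l) | i <- iota 0 10] | l <-
  [:: [:: 0; 1; 2; 3; 4]; [:: 0; 1; 2; 5; 6]; [:: 0; 1; 2; 7; 8]; [:: 0; 1; 3; 5; 7];
      [:: 0; 1; 3; 6; 9]; [:: 0; 1; 4; 8; 9]; [:: 0; 2; 3; 6; 8]; [:: 0; 2; 4; 5; 9];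
      [:: 0; 2; 6; 7; 9]; [:: 0; 3; 4; 6; 7]; [:: 0; 3; 5; 8; 9]; [:: 0; 4; 5; 6; 8]]%N].

Definition bitset (b : bitseq) : {set 'I_10} := [set i : 'I_10 | nth false b i].

Lemma bits_bitset b : size b = 10%N -> bits (enum 'I_10) (bitset b) = b.
Proof.
move=> b10; rewrite /bits (eq_map (g := fun i : 'I_10 => nth false b i)); last by move=> i; rewrite inE.
by rewrite (map_comp (nth false b) val) val_enum_ord -b10 map_nth_iota0 // take_size.
Qed.

(** Its twelve sets exceed the bound ten of [card_fibers2_le10]. *)
Definition halves_family : {set code} := [set c in [seq (inr (bitset b) : code) | b <- halves]].

Lemma halves_size : {in halves, forall b, size b = 10%N}.
Proof. by move=> b bh; apply/eqP; move: b bh; apply/allP. Qed.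

Lemma halves_familyP c : c \in halves_family -> exists2 b, b \in halves & c = inr (bitset b).
Proof. by rewrite inE => /mapP. Qed.

Lemma bitset_inj : {in halves &, injective bitset}.
Proof.
move=> b b' bh bh' E.
by rewrite -(bits_bitset (halves_size bh)) E bits_bitset ?halves_size.
Qed.

Lemma card_halves_family : #|halves_family| = 12%N.
Proof.
rewrite cardsE; apply: (etrans (card_uniqP _)); last by rewrite size_map.
rewrite map_inj_in_uniq; first by vm_compute.
by move=> b b' bh bh' [] /bitset_inj; apply.
Qed.

Lemma halves_compatible : is_compatible halves_family.
Proof.
have cardI b b' : b \in halves -> b' \in halves -> #|bitset b :&: bitset b'| = dotb b b'.
  move=> bh bh'; rewrite -(dotb_bits (perm_refl (enum 'I_10))).
  by rewrite !bits_bitset ?halves_size.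
have meets : all (fun b => all (fun b' => (b == b') || meets23 b b') halves) halves.
  by vm_compute.
have card5 b : b \in halves -> #|bitset b| = 5%N.
  move=> bh; rewrite -[bitset b]setIid cardI //; apply/eqP; move: b bh.
  by apply/allP; vm_compute.
split=> [_ /halves_familyP[b bh ->]|_ _ /halves_familyP[b bh ->] /halves_familyP[b' bh' ->] neq].
  by rewrite /= card5.
apply/compatible_rr; rewrite ?card5 // cardI //.
have /orP[/eqP bb|/orP[] /eqP] := allP (allP meets b bh) b' bh'; [|by left|by right].
by rewrite bb eqxx in neq.
Qed.

Definition pair_code (c : code) : bool := if c is inl _ then true else false.

Lemma compatible_mix c c' : valid c -> valid c' -> pair_code c != pair_code c' -> compatible c c'.
Proof.
case: c c' => [[[s i] E]|D] [[[s' i'] E']|D'] //= /eqP cD /eqP cD' _.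
  exact: compatible_lr.
exact: compatible_rl.
Qed.

Lemma complete_compatible : is_compatible complete_family.
Proof.
split=> [_ /imsetP[E + ->]|_ _ /imsetP[E + ->] /imsetP[E' + ->]]; rewrite !inE //.
move=> /eqP E2 /eqP E2' neq; apply/compatible_ll => //; apply: sum_colour_proper => //.
by apply: contraNneq neq => ->.
Qed.

(** Codes of different kinds are always compatible, so the two kinds can be maximised
    independently. *)
Lemma is_compatibleU (V V' : {set code}) : is_compatible V -> is_compatible V' ->
  {in V, forall c, pair_code c} -> {in V', forall c, ~~ pair_code c} ->
  is_compatible (V :|: V') /\ #|V :|: V'| = (#|V| + #|V'|)%N.
Proof.
move=> [Vv Vc] [Vv' Vc'] Vl Vr; split; last first.
  apply/eqP; rewrite (leq_card_setU V V').2 -setI_eq0; apply/eqP/setP => c.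
  by rewrite !inE; apply/negP => /andP[/Vl cl /Vr]; rewrite cl.
split=> [c|c c']; first by rewrite inE => /orP[/Vv|/Vv'].
rewrite !inE => /orP[] cV /orP[] cV' neq; [exact: Vc| | |exact: Vc'].
  by apply: compatible_mix (Vv c cV) (Vv' c' cV') _; rewrite (Vl c cV) (negPf (Vr c' cV')).
by apply: compatible_mix (Vv' c cV) (Vv c' cV') _; rewrite (Vl c' cV') (negPf (Vr c cV)).
Qed.

Lemma sub_compatible (V V' : {set code}) : V \subset V' -> is_compatible V' -> is_compatible V.
Proof.
move=> /subsetP s [Vv Vc]; split=> [c /s/Vv //|c c' /s cV /s cV'].
exact: Vc.
Qed.

End Families.

Section Maximum.
Variable R : realType.
Local Notation xc := (@xc R).
Local Notation yc := (@yc R).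
Local Notation vec := (@vec R).
Local Notation compatible := (@compatible R).
Local Notation is_compatible := (@is_compatible R).

(** * Structure of a maximum family and the vectors extending it *)

Section Extension.
Variable W : {set code}.
Hypothesis W_compat : is_compatible W.
Hypothesis W_max : forall V, is_compatible V -> (#|V| <= #|W|)%N.

Let W_valid c (cW : c \in W) : valid c := W_compat.1 c cW.

(** Exchanging the edge codes of W for [complete_family] cannot enlarge W. *)
Lemma card_left : (45 <= #|W :&: [set c : code | pair_code c]|)%N.
Proof.
have [V_compat V_card] : is_compatible (complete_family :|: W :\: [set c : code | pair_code c]) /\
    #|complete_family :|: W :\: [set c : code | pair_code c]| =
    (#|complete_family| + #|W :\: [set c : code | pair_code c]|)%N.
  apply: is_compatibleU (complete_compatible R) _ _ _.
  - exact: sub_compatible (subsetDl _ _) W_compat.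
  - by move=> _ /imsetP[E _ ->].
  - by move=> c; rewrite !inE => /andP[].
have := W_max V_compat; rewrite V_card card_complete_family.
by rewrite -(cardsID [set c : code | pair_code c] W) leq_add2r.
Qed.

Lemma card_right : (12 <= #|W :\: [set c : code | pair_code c]|)%N.
Proof.
have [V_compat V_card] : is_compatible (W :&: [set c : code | pair_code c] :|: halves_family) /\
    #|W :&: [set c : code | pair_code c] :|: halves_family| =
    (#|W :&: [set c : code | pair_code c]| + #|halves_family|)%N.
  apply: is_compatibleU _ (halves_compatible R) _ _.
  - exact: sub_compatible (subsetIl _ _) W_compat.
  - by move=> c; rewrite !inE => /andP[].
  - by move=> _ /halves_familyP[b _ ->].
have := W_max V_compat; rewrite V_card card_halves_family.
by rewrite -(cardsID [set c : code | pair_code c] W) leq_add2l.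
Qed.

Definition halves_of : {set {set 'I_10}} := [set D | inr D \in W].

Lemma card_halves_of : (12 <= #|halves_of|)%N.
Proof.
apply: leq_trans card_right _; rewrite -(card_imset _ (@inr_inj _ _ : injective (inr : _ -> code))).
apply: subset_leq_card; apply/subsetP => -[p|D]; rewrite !inE //= => DW.
by apply: imset_f; rewrite inE.
Qed.

Definition support (c : code) : {set 'I_10} := if c is inl (_, _, E) then E else set0.

(** Compatible edge codes have distinct supports, and W contains at least 45 of them, as many as
    there are edges. *)
Lemma pair_covered (E : {set 'I_10}) : #|E| = 2%N -> exists s i, inl (s, i, E) \in W.
Proof.
move=> E2.
have inj : {in W :&: [set c : code | pair_code c] &, injective support}.
  move=> [[[s i] D]|D] [[[s' i'] D']|D']; rewrite !inE ?andbF // !andbT /= => cW cW' DD.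
  apply/eqP; apply: contraT => neq.
  have /eqP D2 := W_valid cW; have /eqP D2' := W_valid cW'.
  have /compatible_ll-/(_ D2 D2') := W_compat.2 _ _ cW cW' neq.
  by rewrite DD setIid D2' addn2.
have sub : support @: (W :&: [set c : code | pair_code c]) \subset pairs.
  apply/subsetP => _ /imsetP[[[[s i] D]|D] + ->]; rewrite !inE ?andbF // andbT.
  by move=> /W_valid.
have : E \in support @: (W :&: [set c : code | pair_code c]).
  have /eqP -> : support @: (W :&: [set c : code | pair_code c]) == pairs.
    by rewrite eqEcard sub card_pairs card_in_imset // card_left.
  by rewrite inE E2.
move=> /imsetP[[[[s i] D]|D]]; rewrite !inE ?andbF // andbT => cW ->.
by exists s, i.
Qed.

(** The default [ord0] is reached only for j = k, since otherwise the edge is covered. *)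
Definition colour (j k : 'I_10) : 'I_10 :=
  odflt ord0 [pick i | [exists s, inl (s, i, [set j; k]) \in W]].

Lemma colour_sym j k : colour j k = colour k j.
Proof. by rewrite /colour setUC. Qed.

Lemma colourP j k : j != k -> exists s, inl (s, colour j k, [set j; k]) \in W.
Proof.
move=> jk; rewrite /colour; case: pickP => [i /existsP //|none].
have [|s [i siW]] := @pair_covered [set j; k]; first by rewrite cards2 jk.
by have := none i; rewrite (introT existsP) //; exists s.
Qed.

Lemma colour_inj j k l : j != k -> j != l -> colour j k = colour j l -> k = l.
Proof.
move=> jk jl E; apply/eqP; apply: contraT => kl.
have [s sW] := colourP jk; have [s' sW'] := colourP jl.
have D2 : #|[set j; k]| = 2%N by rewrite cards2 jk.
have D2' : #|[set j; l]| = 2%N by rewrite cards2 jl.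
have neq : inl (s, colour j k, [set j; k]) != inl (s', colour j l, [set j; l]) :> code.
  apply: contra kl => /eqP[_ _ /setP/(_ k)]; rewrite !inE eqxx orbT => /esym.
  by rewrite eq_sym (negPf jk).
have /compatible_ll-/(_ D2 D2') := W_compat.2 _ _ sW sW' neq.
rewrite E eqxx (cardsD1 j) !inE !eqxx /=; lia.
Qed.

Section Vector.
Variables (x y : 'rV[R]_10) (z : 'rV[R]_2).
Hypothesis g_r0 : dotv (vec3 x y z) r0 = 1.
Hypothesis g_norm : dotv (vec3 x y z) (vec3 x y z) <= 3.
Hypothesis g_W : {in W, forall c,
  dotv (vec3 x y z) (vec c) = 0 \/ dotv (vec3 x y z) (vec c) = 1}.

(** Subtracting the means projects x and y to the span of A_9; the means are invisible to codes and
    vanish only at the end, by the norm bound. *)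
Let mean (t : 'rV[R]_10) := (\sum_i t 0 i) / 10.
Let a (i : 'I_10) := x 0 i - mean x.
Let b (j : 'I_10) := y 0 j - mean y.

Let sum_a : \sum_i a i = 0.
Proof. by rewrite sumrB sumr_const card_ord -[_ *+ 10]mulr_natl /mean; field. Qed.

Let sum_b : \sum_j b j = 0.
Proof. by rewrite sumrB sumr_const card_ord -[_ *+ 10]mulr_natl /mean; field. Qed.

Lemma sum_mul_shift (t : 'I_10 -> R) (p : R) (D : {set 'I_10}) : \sum_i t i = 0 ->
  \sum_i t i * (p - (i \in D)%:R) = - \sum_(i in D) t i.
Proof.
move=> t0; under eq_bigr do rewrite mulrBr.
rewrite sumrB -mulr_suml t0 mul0r sub0r; congr (- _).
rewrite [RHS]big_mkcond; apply: eq_bigr => i _.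
by case: (i \in D); rewrite ?mulr1 ?mulr0.
Qed.

Lemma sum_xc c : valid c -> \sum_i xc c i = 0.
Proof.
case: c => [[[s i0] D]|D] /= /eqP cD; last by rewrite sum_shift cD; field.
by rewrite -mulr_sumr sum_shift cards1; field.
Qed.

Lemma sum_yc c : valid c -> \sum_i yc c i = 0.
Proof.
case: c => [[[s i0] D]|D] /= /eqP cD; last by rewrite big1.
by rewrite -mulr_sumr sum_shift cD; field.
Qed.

Lemma dotv_center c : valid c ->
  dotv (vec3 x y z) (vec c) = \sum_i a i * xc c i + \sum_i b i * yc c i + 1 / 2.
Proof.
move=> vc; rewrite dotv_vec3 dotv2; have [h0 h1] := alpha1E R.
have -> : z 0 ord0 * alpha R 1 0 ord0 + z 0 ord_max * alpha R 1 0 ord_max = 1 / 2.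
  by move: g_r0; rewrite dotv_r0 h0 h1; lra.
congr (_ + _ + _); rewrite /dotv.
  under [RHS]eq_bigr do rewrite mulrBl; rewrite sumrB -mulr_sumr sum_xc // mulr0 subr0.
  by apply: eq_bigr => i _; rewrite mxE.
under [RHS]eq_bigr do rewrite mulrBl; rewrite sumrB -mulr_sumr sum_yc // mulr0 subr0.
by apply: eq_bigr => i _; rewrite mxE.
Qed.

(** The inner product being 0 or 1 means that a_i + b_j + b_k is 1/2 or -1/2 for the colour i;
    modulo 1 the sign of the code disappears. *)
Lemma edge_int j k : j != k -> b j + b k - (1 / 2 - a (colour j k)) \is a Num.int.
Proof.
move=> jk; have [s sW] := colourP jk.
have := g_W sW; rewrite dotv_center ?W_valid // /=.
under eq_bigr do rewrite mulrCA; under [X in _ + X + _]eq_bigr do rewrite mulrCA.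
rewrite -!mulr_sumr !sum_mul_shift // big_set1 big_setU1 ?inE // big_set1 /=.
set t := b j + b k - _.
have eqt : t = a (colour j k) + (b j + b k) - 1 / 2 by rewrite /t; ring.
case: (signP R s) => -> H; have [->|->] : t = 0 \/ t = -1
  by rewrite eqt; case: H => H; (left; lra) || (right; lra).
all: by rewrite ?rpredN ?rpred0 ?rpred1.
Qed.

Lemma half_int D : inr D \in W -> \sum_(i in D) (1 / 2 - a i) \is a Num.int.
Proof.
move=> DW; have /eqP D5 := W_valid DW.
have := g_W DW; rewrite dotv_center ?W_valid // /=.
rewrite sum_mul_shift // [X in _ + X + _]big1 => [|i _]; last by rewrite mulr0.
have -> : \sum_(i in D) (1 / 2 - a i) = 5 * (1 / 2) - \sum_(i in D) a i.
  by rewrite [LHS]sumrB sumr_const D5 mulr_natl.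
move: (\sum_(i in D) a i) => t H.
have [->|->] : 5 * (1 / 2) - t = 2 \/ 5 * (1 / 2) - t = 3
  by case: H => H; [left|right]; lra.
all: by rewrite natr_int.
Qed.

Lemma circ_eq (u v : R) : u - v \is a Num.int -> circ u = circ v.
Proof. by move=> uv; rewrite -[u](subrK v) circD circ_int ?mul1r. Qed.

Lemma eq_circ (u v : R) : circ u = circ v -> u - v \is a Num.int.
Proof. by move=> uv; apply: circ_eq1; rewrite circD uv -circD subrr circ0. Qed.

Lemma sum_sqr_center (t : 'rV[R]_10) :
  dotv t t = \sum_i (t 0 i - mean t) ^+ 2 + 10 * mean t ^+ 2.
Proof.
have t0 : \sum_i (t 0 i - mean t) = 0.
  by rewrite sumrB sumr_const card_ord -[_ *+ 10]mulr_natl /mean; field.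
transitivity (\sum_i ((t 0 i - mean t) ^+ 2 + mean t ^+ 2 + 2 * mean t * (t 0 i - mean t))).
  by apply: eq_bigr => i _; ring.
by rewrite big_split big_split /= sumr_const card_ord -mulr_sumr t0 mulr0 addr0 mulr_natl.
Qed.

Lemma vector_is_code : exists2 c, valid c & vec3 x y z = vec c.
Proof.
have two_neq0 : 2%:R != 0 :> R[i] by rewrite pnatr_eq0.
have mul_z j k : j != k -> circ (b j) * circ (b k) = circ (1 / 2 - a (colour j k)).
  by move=> jk; rewrite -circD; apply: circ_eq; exact: edge_int.
have prod_z : \prod_j circ (b j) = 1 by rewrite -circ_sum sum_b circ0.
have prod_w : \prod_i circ (1 / 2 - a i) = 1.
  rewrite -circ_sum circ_int // sumrB sum_a subr0 sumr_const card_ord -[_ *+ 10]mulr_natl.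
  by rewrite (_ : 10 * (1 / 2) = 5) ?natr_int //; field.
case: (product_coloring two_neq0 (fun j => circ_neq0 (b j)) colour_sym colour_inj
    mul_z prod_z prod_w) => [[t tE]|w5]; last first.
  (* Case of fifth roots of unity: at most ten five-sets are possible, but W has at least twelve. *)
  have := card_halves_of; rewrite ltnNge => /negP[].
  rewrite ltnW // ltnS; apply: (card_fibers2_le10 w5 prod_w).
    move=> D; rewrite inE => DW; split; first by have /eqP := W_valid DW.
    by rewrite -circ_sum circ_int ?half_int.
  move=> D E; rewrite !inE => DW EW DE.
  have /eqP D5 := W_valid DW; have /eqP E5 := W_valid EW.
  by apply/(compatible_rr R D5 E5)/W_compat.2 => //; apply: contraNneq DE => -[->].
(* Constant case: a and b lie in the dual lattice, and w = t^2 supplies the glue condition. *)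
have a_int i : a i - a ord0 \is a Num.int.
  rewrite -opprB rpredN (_ : _ - _ = (1 / 2 - a i) - (1 / 2 - a ord0)); last by ring.
  by apply: eq_circ; rewrite (tE i).2 (tE ord0).2.
have b_int j : b j - b ord0 \is a Num.int.
  by apply: eq_circ; rewrite (tE j).1 (tE ord0).1.
have ab_int : a ord0 + 2 * b ord0 - 1 / 2 \is a Num.int.
  rewrite (_ : _ - _ = (b ord0 + b ord0) - (1 / 2 - a ord0)); last by ring.
  by apply: eq_circ; rewrite (tE ord0).2 circD (tE ord0).1.
have z01 : z 0 ord0 = 1 + z 0 ord_max by move: g_r0; rewrite dotv_r0; lra.
have := g_norm; rewrite dotv_vec3 dotv2 !sum_sqr_center -/(a _) -/(b _) z01 => norm.
have sqA := sqr_ge0 (mean x); have sqB := sqr_ge0 (mean y).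
(* Given the condition on r, the norm of z is 1/2 plus half of this square. *)
have sqz := sqr_ge0 (1 + 2 * z 0 ord_max).
have short : \sum_i a i ^+ 2 + \sum_j b j ^+ 2 <= 5 / 2.
  by move: norm sqA sqB sqz; rewrite /a /b; nra.
have [c [vc aE bE]] := short_vectors sum_a sum_b a_int b_int ab_int short.
have norm_c : \sum_i a i ^+ 2 + \sum_j b j ^+ 2 = 5 / 2.
  rewrite -(cdot_self R vc); congr (_ + _); apply: eq_bigr => i _.
    by rewrite aE expr2.
  by rewrite bE expr2.
(* The bound is restated with [a] and [b] folded. As the code already has norm 5/2, no room is left
   for the squares of the means and of 1 + 2 z_1. *)
have {norm} norm : \sum_i a i ^+ 2 + 10 * mean x ^+ 2 + (\sum_j b j ^+ 2 + 10 * mean y ^+ 2) +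
  ((1 + z 0 ord_max) * (1 + z 0 ord_max) + z 0 ord_max * z 0 ord_max) <= 3 := norm.
have mean_x : mean x = 0 by apply/eqP; rewrite -sqrf_eq0; apply/eqP; nra.
have mean_y : mean y = 0 by apply/eqP; rewrite -sqrf_eq0; apply/eqP; nra.
have z1 : 1 + 2 * z 0 ord_max = 0 by apply/eqP; rewrite -sqrf_eq0; apply/eqP; nra.
exists c => //; rewrite /vec; congr vec3; apply/rowP => i.
- by rewrite mxE -aE /a mean_x subr0.
- by rewrite mxE -bE /b mean_y subr0.
have [h0 h1] := alpha1E R; rewrite alphaE.
have [->|->] : i = ord0 \/ i = ord_max.
  by case: i => [[|[|//]] i2]; [left|right]; apply: val_inj.
  by rewrite z01 /=; lra.
by rewrite eqxx /=; lra.
Qed.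

End Vector.
End Extension.

(** * Reduction from the enlarged space *)

Lemma dotv_widen d k (u v : 'rV[R]_d) : dotv (widen k u) (widen k v) = dotv u v.
Proof.
rewrite dotv_row_mx [X in _ + X]big1 ?addr0 // => i _.
by rewrite mxE mulr0.
Qed.

Lemma dotv_ge0 d (u : 'rV[R]_d) : 0 <= dotv u u.
Proof. by apply: sumr_ge0 => i _; rewrite -expr2 sqr_ge0. Qed.

Lemma dotv_eq0 d (u : 'rV[R]_d) : dotv u u = 0 -> u = 0.
Proof.
move=> /eqP; rewrite psumr_eq0 => [/allP u0|i _]; last by rewrite -expr2 sqr_ge0.
apply/rowP => i; rewrite mxE; apply/eqP.
by have := u0 i (mem_index_enum _); rewrite /= mulf_eq0 orbb.
Qed.

End Maximum.

Local Close Scope ring_scope.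

Theorem theorem8p4 (R : realType) (w : {fset 'rV[R]_(10 + 10 + 2)}) :
  maximum_in r0 X0 w -> strongly_maximal r0 w.
Proof.
move=> [w_eq w_X w_max].
(* By [X0P] the set w consists of the vectors of these codes, so its maximality becomes that of
   W. *)
pose W : {set code} := [set c | valid c && (vec R c \in w)].
have wE : w = vecs R W.
  apply/fsetP => u; apply/idP/vecsP => [uw|[c]]; last by rewrite inE => /andP[_ cw ->].
  have /X0P[c vc uE] := w_X u uw.
  by exists c => //; rewrite inE vc -uE.
have W_compat : is_compatible R W.
  split=> [c|c c']; first by rewrite inE => /andP[].
  rewrite !inE => /andP[vc cw] /andP[vc' cw'] neq.
  have [s [_ _ pairs_w]] := w_eq; apply: pairs_w => //.
  by apply: contraNneq neq => /vec_inj ->.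
have card_w : #|` w| = #|W| by rewrite {1}wE; have [] := vecs_equiangular W_compat.
have W_max V : is_compatible R V -> (#|V| <= #|W|)%N.
  move=> /vecs_equiangular[V_eq VX <-]; rewrite -card_w; apply: w_max => //.
split=> // k w' [s [root_r dots pairs_w']] /andP[sub nsub].
have {}sub c : c \in W -> widen k (vec R c) \in w'.
  move=> cW; apply: (fsubsetP sub); apply: in_imfset => /=.
  by move: cW; rewrite inE => /andP[].
have /fsubsetPn[v vw' v_new] := nsub.
(* A vector common to w and w' is needed to see that the norm of w' is also 3. *)
have [c0 c0W] : exists c, c \in W.
  apply/card_gt0P; rewrite -(cardsID [set c : code | pair_code c] W).
  by rewrite addn_gt0; have := card_left W_compat W_max; case: #|_|.
have [u_r0 u_s] := dots _ (sub _ c0W).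
have s3 : s = 3%:R%R.
  rewrite -u_s dotv_widen dotv_vec cdot_self; first by field.
  exact: W_compat.1.
have [v_r0 v_s] := dots v vw'.
have v_W c : c \in W -> (dotv v (widen k (vec R c)) = 0 \/ dotv v (widen k (vec R c)) = 1)%R.
  move=> cW; apply: pairs_w' => //; first exact: sub.
  apply: contraNneq v_new => ->; apply: in_imfset => /=.
  by move: cW; rewrite inE => /andP[].
(* Only the projection g of v to the original space enters inner products with w, and its norm is at
   most 3. *)
pose g := lsubmx v; pose x := lsubmx (lsubmx g); pose y := rsubmx (lsubmx g).
pose z := rsubmx g; have gE : g = vec3 x y z by rewrite /vec3 !hsubmxK.
have vE : v = row_mx g (rsubmx v) by rewrite hsubmxK.
have dot_g u : dotv v (widen k u) = dotv g u.
  rewrite {1}vE dotv_row_mx [X in (_ + X)%R]big1 ?addr0 // => i _.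
  by rewrite [X in (_ * X)%R]mxE mulr0.
have g_norm : (dotv g g + dotv (rsubmx v) (rsubmx v) = 3)%R.
  by rewrite -dotv_row_mx -vE v_s s3.
have [] := @vector_is_code R W W_compat W_max x y z.
- by rewrite -gE -dot_g.
- by rewrite -gE -g_norm lerDl dotv_ge0.
- by move=> c cW; rewrite -gE -dot_g; exact: v_W.
rewrite -gE => c vc gc.
(* The code vector g already has norm 3, so v has no component in the new dimensions. *)
have v0 : rsubmx v = 0%R.
  apply: dotv_eq0; move: g_norm; rewrite gc dotv_vec cdot_self //; lra.
have {vE} vE : v = widen k (vec R c) by rewrite vE v0 gc.
have cW : c \notin W.
  apply: contra v_new => cW; rewrite vE; apply: in_imfset => /=.
  by move: cW; rewrite inE => /andP[].
have c_compat c' : c' \in W -> compatible R c c'.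
  by move=> cW'; have := v_W c' cW'; rewrite vE dotv_widen.
have /W_max : is_compatible R (c |: W).
  split=> [c'|c' c'']; rewrite !in_setU1; first by case/orP=> [/eqP->//|]; exact: W_compat.1.
  case/orP=> [/eqP->|cW'] /orP[/eqP->|cW''] neq.
  - by rewrite eqxx in neq.
  - exact: c_compat.
  - exact/compatibleC/c_compat.
  exact: W_compat.2.
by rewrite cardsU1 cW ltnn.
Qed.
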